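(* Let $m\ge1$ and let $T_1,\dots,T_m$ be commuting contractions on a Hilbert space $\mathcal{H}$. Let $\mathbb{N}^{m\times\infty}$ be the free abelian unital semigroup on generators $e_{i,j}$, $1\le i\le m$, $j\in\mathbb{N}$, and let $T^\infty:\mathbb{N}^{m\times\infty}\to\mathcal{B}(\mathcal{H})$ be the representation sending each generator $e_{i,j}$ to $T_i$. Then $T^\infty$ is regular if and only if for all integers $n_1,\dots,n_m\ge0$, $$\sum_{0\le k_i\le n_i}(-1)^{k_1+k_2+\cdots+k_m}\binom{n_1}{k_1}\cdots\binom{n_m}{k_m}\,T_1^{*k_1}T_2^{*k_2}\cdots T_m^{*k_m}T_m^{k_m}\cdots T_1^{k_1}\ \ge\ 0.$$
   Context: $\mathbb{N}^{m\times\infty}$ is the semigroup of finitely supported families $(t_{i,j})_{1\le i\le m,\,j\in\mathbb{N}}$ of nonnegative integers under coordinatewise addition; it sits inside the group $\mathbb{Z}^{m\times\infty}$ of finitely supported families of integers. For $g=(g_{i,j})\in\mathbb{Z}^{m\times\infty}$ put $g_+=(\max(g_{i,j},0))$ and $g_-=(\max(-g_{i,j},0))$, so $g=g_+-g_-$. A representation $S:\mathbb{N}^{m\times\infty}\to\mathcal{B}(\mathcal{H})$ (a unital semigroup homomorphism into the bounded operators under multiplication) is regular if there are a Hilbert space $\mathcal{K}\supseteq\mathcal{H}$ and a unitary representation $U:\mathbb{Z}^{m\times\infty}\to\mathcal{B}(\mathcal{K})$ such that $S(g_-)^*S(g_+)=P_{\mathcal{H}}U(g)|_{\mathcal{H}}$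 for every $g\in\mathbb{Z}^{m\times\infty}$, where $P_{\mathcal{H}}$ is the orthogonal projection of $\mathcal{K}$ onto $\mathcal{H}$. *)

(* Defs.v *)
From HB Require Import structures.
From mathcomp Require Import all_boot all_order all_algebra finmap complex.
From mathcomp Require Import sesquilinear.
From mathcomp Require Import all_classical all_reals all_analysis.
From mathcomp Require Import ring lra.

Set Implicit Arguments.
Unset Strict Implicit.
Unset Printing Implicit Defensive.

Import Order.TTheory GRing.Theory Num.Theory Num.Def.
Import numFieldNormedType.Exports.

Local Open Scope classical_set_scope.
Local Open Scope complex_scope.
Local Open Scope ring_scope.

(* The inner product is linear in its first argument and conjugate-linear in
   the second. Norms are real elements of R[i]. *)
HB.mixin Record NormedModule_isHilbert (R : realType) H
    & CompleteNormedModule R[i] H := {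
  inner : {dot H for (@conjC R[i])};
  inner_norm : forall x : H, inner x x = `|x| ^+ 2
}.

#[short(type="hilbertType")]
HB.structure Definition Hilbert (R : realType) :=
  {H of CompleteNormedModule R[i] H & NormedModule_isHilbert R H}.

Notation "''[' x , y ]" := (inner x y) (format "''[' x ,  y ]") : ring_scope.

Record bounded_operator (R : realType) (H : hilbertType R) := BoundedOperator {
  op_fun :> {linear H -> H};
  op_bounded : exists M : R[i], forall x, `|op_fun x| <= M * `|x|
}.

Notation "''B(' H )" := (bounded_operator H) (format "''B(' H )") : type_scope.

Section Operators.
Context {R : realType} {H : hilbertType R}.
Implicit Types (A : 'B(H)) (x y z : H).

(* A^* y is the vector z such that '[A x, y] = '[x, z] for all x; it exists
   (adjP below) and is unique. *)
Definition adj A y : H := xget 0 [set z | forall x, '[A x, y] = '[x, z]].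

Definition contractive A := forall x, `|A x| <= `|x|.

Definition unitary A := forall x, adj A (A x) = x /\ A (adj A x) = x.

(* In R[i], 0 <= z means that z is real and nonnegative. *)
Definition positive_op (f : H -> H) := forall x, 0 <= '[f x, x].

Definition orthogonal_projection (M : set H) A :=
  forall x, M (A x) /\ forall y, M y -> '[x - A x, y] = 0.

Definition representation (M : nmodType) (S : M -> 'B(H)) :=
  (forall x, S 0 x = x) /\ (forall s t x, S (s + t) x = S s (S t x)).

End Operators.

Section InnerTheory.
Context {R : realType} {H : hilbertType R}.
Implicit Types (x y z : H) (a : R[i]).

Lemma innerC x y : '[y, x] = ('[x, y])^*%C.
Proof. by rewrite hermC expr0 mul1r. Qed.

Lemma inner_inj y z : (forall x, '[x, y] = '[x, z]) -> y = z.
Proof.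
move=> h; apply/eqP; rewrite -subr_eq0 -normr_eq0 -sqrf_eq0.
by rewrite -inner_norm linearBr /= h subrr.
Qed.

Let nr x : R := complex.Re `|x|.
Let rdot x y : R := complex.Re '[x, y].

Let nrE x : `|x| = (nr x)%:C.
Proof. by rewrite /nr RRe_real // normr_real. Qed.

Let nr_ge0 x : 0 <= nr x.
Proof. by rewrite -ler0c -nrE. Qed.

Let rdotxx x : rdot x x = nr x ^+ 2.
Proof. by rewrite /rdot inner_norm nrE -rmorphXn. Qed.

Let rdotC x y : rdot x y = rdot y x.
Proof. by rewrite /rdot innerC; case: ('[_, _]). Qed.

Let rdotDl x y z : rdot (x + y) z = rdot x z + rdot y z.
Proof. by rewrite /rdot linearDl /= raddfD. Qed.

Let rdotZl (a : R) x z : rdot (a%:C *: x) z = a * rdot x z.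
Proof.
by rewrite /rdot linearZl_LR /=; case: ('[_, _]) => u v /=; rewrite mul0r subr0.
Qed.

Let rdotDr x y z : rdot z (x + y) = rdot z x + rdot z y.
Proof. by rewrite rdotC rdotDl !(rdotC z). Qed.

Let rdotZr (a : R) x z : rdot z (a%:C *: x) = a * rdot z x.
Proof. by rewrite rdotC rdotZl rdotC. Qed.

Let rdotNl x z : rdot (- x) z = - rdot x z.
Proof. by rewrite /rdot linearNl /= raddfN. Qed.

Let rdotNr x z : rdot z (- x) = - rdot z x.
Proof. by rewrite rdotC rdotNl rdotC. Qed.

Let rdotE := (rdotDl, rdotDr, rdotZl, rdotZr, rdotNl, rdotNr).

Let rdot_le x y : rdot x y <= nr x * nr y.
Proof.
have nr0 z : nr z = 0 -> z = 0.
  by move=> z0; apply/eqP; rewrite -normr_eq0 nrE z0.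
have [x0|x0] := eqVneq (nr x) 0.
  by rewrite x0 mul0r (nr0 _ x0) /rdot linear0l.
have [y0|y0] := eqVneq (nr y) 0.
  by rewrite y0 mulr0 (nr0 _ y0) /rdot linear0r.
have : 0 <= rdot ((nr y)%:C *: x - (nr x)%:C *: y)
                 ((nr y)%:C *: x - (nr x)%:C *: y) by rewrite rdotxx sqr_ge0.
rewrite !rdotE !rdotxx (rdotC y x) => h.
have xy : 0 < nr x * nr y by rewrite mulr_gt0 // lt0r ?x0 ?y0 nr_ge0.
rewrite -(ler_pM2l xy); nra.
Qed.

(* the existence half of the Riesz representation theorem *)
Let rdot_riesz (A : 'B(H)) y : exists z, forall x, rdot (A x) y = rdot x z.
Proof.
pose g x := rdot (A x) y.
have gD u v : g (u + v) = g u + g v by rewrite /g linearD rdotDl.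
have gZ (a : R) u : g (a%:C *: u) = a * g u by rewrite /g linearZ /= rdotZl.
have gN u : g (- u) = - g u by rewrite /g linearN rdotNl.
have [C C0 gC] : exists2 C, 0 <= C & forall x, g x <= C * nr x.
  have [M AM] := op_bounded A; exists (`|complex.Re M| * nr y).
    by rewrite mulr_ge0.
  move=> x; apply: (le_trans (rdot_le _ _)).
  rewrite mulrAC ler_wpM2r //.
  have := AM x; rewrite !nrE lecE => /andP[_].
  case: M {AM} => u v /=; rewrite mulr0 subr0 => /le_trans; apply.
  by rewrite ler_wpM2r // ler_norm.
pose q x := rdot x x - 2 * g x.
have q_ge x : - C ^+ 2 <= q x.
  rewrite /q rdotxx; have := gC x; have := sqr_ge0 (nr x - C); nra.
have inf_q : has_inf (range q).
  by split; [exists (q 0), 0 | exists (- C ^+ 2) => _ [x _ <-]].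
pose d := inf (range q).
have d_le x : d <= q x by apply: (inf_lbound inf_q.2); exists x.
pose F := filter_from [set e : R | 0 < e] (fun e => [set x | q x < d + e]).
have FF : ProperFilter F.
  apply: filter_from_proper; last first.
    by move=> e /= e0; have [_ [x _ <-] qx] := inf_adherent e0 inf_q; exists x.
  apply: filter_from_filter; first by exists 1 => /=.
  move=> e1 e2 /= e10 e20; exists (Num.min e1 e2).
    by rewrite /= lt_min e10.
  by move=> x /=; rewrite -ltrBlDl lt_min !ltrBlDl => /andP.
have par u v : nr (u - v) ^+ 2 <= 2 * (q u - d) + 2 * (q v - d).
  have := d_le (2^-1%:C *: (u + v)).
  rewrite -rdotxx /q gZ gD !rdotE (rdotC v u); lra.
have Fc : cauchy F.
  apply/cauchyP => eps eps0.
  have [r r0 ->] : exists2 r : R, 0 < r & eps = r%:C.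
    exists (complex.Re eps); last by rewrite RRe_real // gtr0_real.
    by rewrite -ltcR RRe_real // gtr0_real.
  have e0 : 0 < r ^+ 2 / 4 by rewrite divr_gt0 // exprn_gt0.
  have [_ [x _ <-] qx] := inf_adherent e0 inf_q.
  exists x; exists (r ^+ 2 / 4) => // v /= qv.
  rewrite -ball_normE /= nrE ltcR.
  rewrite -(@ltr_pXn2r _ 2) ?nnegrE // ?(ltW r0) //.
  apply: (le_lt_trans (par _ _)); move: qx; rewrite -/d; lra.
have [z Fz] : exists z, F --> z by apply/cvg_ex; exact: cauchy_cvg.
have near_z (e : R) : 0 < e -> exists x, nr (z - x) < e /\ q x < d + e.
  move=> e0; have Be : F (ball z e%:C).
    by apply: Fz; apply: nbhsx_ballx; rewrite ltcR.
  have Fe : F [set x | q x < d + e] by exists e.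
  have [x []] := filter_ex (filterI Be Fe).
  by rewrite -ball_normE /= nrE ltcR; exists x.
have qz : q z <= d.
  apply/ler_addgt0Pr => e e0.
  pose k := 2 * nr z + 2 * C + 2.
  have k0 : 0 < k by rewrite /k; have := nr_ge0 z; lra.
  pose t := Num.min 1 (e / k).
  have t0 : 0 < t by rewrite lt_min ltr01 divr_gt0.
  have [x [xz qx]] := near_z _ t0.
  have tk : t * k <= e by rewrite -ler_pdivlMr // ge_min lexx orbT.
  have t1 : t <= 1 by rewrite ge_min lexx.
  have qE : q z = q x + 2 * rdot z (z - x) - nr (z - x) ^+ 2 - 2 * g (z - x).
    rewrite -rdotxx /q gD gN !rdotE (rdotC x z); ring.
  have gzx : - g (z - x) <= C * nr (z - x).
    rewrite -gN opprB; apply: (le_trans (gC _)).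
    by rewrite /nr distrC.
  have := rdot_le z (z - x); have := nr_ge0 (z - x); have := nr_ge0 z.
  move: tk; rewrite /k qE => tk z0 w0 zw.
  have : nr z * nr (z - x) <= nr z * t by rewrite ler_wpM2l // ltW.
  have : C * nr (z - x) <= C * t by rewrite ler_wpM2l // ltW.
  have := sqr_ge0 (nr (z - x)); lra.
exists z => x; apply/eqP; rewrite -/(g x) -subr_eq0; apply/eqP.
set b := g x - rdot x z.
pose s := b / (nr x ^+ 2 + 1).
have n0 : 0 < nr x ^+ 2 + 1 by rewrite ltr_wpDl // sqr_ge0.
have sE : b = s * (nr x ^+ 2 + 1) by rewrite /s divfK // gt_eqF.
have := le_trans qz (d_le (z + s%:C *: x)).
rewrite /q gD gZ !rdotE !rdotxx (rdotC z x) => h.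
have {}h : 2 * (s * b) <= s ^+ 2 * nr x ^+ 2 by rewrite /b; lra.
have s2 : s ^+ 2 = 0.
  apply/eqP; rewrite eq_le sqr_ge0 andbT.
  move: h; rewrite sE; have := sqr_ge0 s; have := sqr_ge0 (s * nr x); nra.
by rewrite sE; move/eqP: s2; rewrite expf_eq0 /= => /eqP ->; rewrite mul0r.
Qed.

Lemma adjP (A : 'B(H)) x y : '[A x, y] = '[x, adj A y].
Proof.
suff [z zP] : exists z, forall x, '[A x, y] = '[x, z].
  have -> // := @xgetPex H 0 [set z | forall x, '[A x, y] = '[x, z]]; by exists z.
have [z zP] := rdot_riesz A y; exists z => {}x.
apply/eqP; rewrite eq_complex -/(rdot _ _) zP eqxx /=.
have := zP ('i%C *: x); rewrite /rdot linearZ !linearZl_LR /=.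
by case: ('[_, _]) => u v; case: ('[_, _]) => u' v' /=; lra.
Qed.

End InnerTheory.

(* Finitely supported families indexed by K, under coordinatewise addition. *)
Definition finfam (K : choiceType) (V : nmodType) := {fsfun K -> V with 0}.

Section FinFam.
Context {K : choiceType}.

Section Nmodule.
Context {V : nmodType}.
Implicit Types s t u : finfam K V.

HB.instance Definition _ := Choice.on (finfam K V).

Definition finfam_zero : finfam K V := [fsfun].
Definition finfam_add s t : finfam K V :=
  [fsfun p in (finsupp s `|` finsupp t)%fset => s p + t p].

Lemma finfam_zeroE p : finfam_zero p = 0.
Proof. exact: fsfun0E. Qed.

Lemma finfam_addE s t p : finfam_add s t p = s p + t p.
Proof.
rewrite fsfun_fun in_fsetU.
by case: finsuppP => [_|?]; case: finsuppP => [_|?] //=; rewrite addr0.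
Qed.

Lemma finfam_addA : associative finfam_add.
Proof. by move=> s t u; apply/fsfunP => p; rewrite !finfam_addE addrA. Qed.

Lemma finfam_addC : commutative finfam_add.
Proof. by move=> s t; apply/fsfunP => p; rewrite !finfam_addE addrC. Qed.

Lemma finfam_add0 : left_id finfam_zero finfam_add.
Proof.
by move=> s; apply/fsfunP => p; rewrite finfam_addE finfam_zeroE add0r.
Qed.

HB.instance Definition _ := GRing.isNmodule.Build (finfam K V)
  finfam_addA finfam_addC finfam_add0.

Lemma finfamD s t p : (s + t) p = s p + t p.
Proof. exact: finfam_addE. Qed.

Lemma finfam0 p : (0 : finfam K V) p = 0.
Proof. exact: finfam_zeroE. Qed.

End Nmodule.

Section Zmodule.
Context {V : zmodType}.
Implicit Types s t u : finfam K V.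

Definition finfam_opp s : finfam K V := [fsfun p in finsupp s => - s p].

Lemma finfam_oppE s p : finfam_opp s p = - s p.
Proof. by rewrite fsfun_fun; case: finsuppP => //; rewrite oppr0. Qed.

Lemma finfam_addN : left_inverse (0 : finfam K V) finfam_opp +%R.
Proof.
by move=> s; apply/fsfunP => p; rewrite finfamD finfam_oppE addNr finfam0.
Qed.

HB.instance Definition _ :=
  GRing.Nmodule_isZmodule.Build (finfam K V) finfam_addN.

End Zmodule.

Definition finfam_delta (p : K) : finfam K nat := [fsfun [fsfun] with p |-> 1%N].

(* g_+ and g_- *)
Definition pos_part (g : finfam K int) : finfam K nat :=
  [fsfun p in finsupp g => `|Num.max (g p) 0|%N].

Definition neg_part (g : finfam K int) : finfam K nat :=
  [fsfun p in finsupp g => `|Num.max (- g p) 0|%N].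

Lemma finfam_deltaE p q : finfam_delta p q = (q == p).
Proof. by rewrite fsfun_withE finfam_zeroE; case: eqP. Qed.

Lemma pos_partE g p : (pos_part g p)%:Z = Num.max (g p) 0.
Proof.
rewrite fsfun_fun; case: finsuppP => [_|?]; first by rewrite maxxx.
by rewrite gez0_abs // le_max lexx orbT.
Qed.

Lemma neg_partE g p : (neg_part g p)%:Z = Num.max (- g p) 0.
Proof.
rewrite fsfun_fun; case: finsuppP => [_|?]; first by rewrite oppr0 maxxx.
by rewrite gez0_abs // le_max lexx orbT.
Qed.

End FinFam.

(* N^{m x infty}, Z^{m x infty} and the generators e_{i,j} *)
Definition Nfam (m : nat) := finfam ('I_m * nat)%type nat.
Definition Zfam (m : nat) := finfam ('I_m * nat)%type int.
Definition gen (m : nat) (i : 'I_m) (j : nat) : Nfam m := finfam_delta (i, j).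

(* Commuting operators T_i do extend to a representation sending e_{i,j} to
   T_i, so quantifying over such representations is not vacuous. *)
Section FreeRepresentation.
Context {R : realType} {H : hilbertType R} {m : nat}.
Implicit Types (A B : 'B(H)) (t : Nfam m).

Lemma op_id_bounded : exists M : R[i], forall x : H, `|idfun x| <= M * `|x|.
Proof. by exists 1 => x; rewrite mul1r. Qed.

Definition op_id : 'B(H) := BoundedOperator op_id_bounded.

Lemma op_comp_bounded A B :
  exists M : R[i], forall x, `|(A \o B) x| <= M * `|x|.
Proof.
have [M AM] := op_bounded A; have [N BN] := op_bounded B.
exists (`|M| * N) => x /=; apply: (@le_trans _ _ (`|M| * `|B x|)).
  by rewrite -(normr_id (B x)) -normrM ger0_norm // (le_trans _ (AM _)).
by rewrite -mulrA ler_wpM2l.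
Qed.

Definition op_comp A B : 'B(H) := BoundedOperator (op_comp_bounded A B).

Let degree t (i : 'I_m) : nat :=
  (\sum_(p <- finsupp t | p.1 == i) t p)%N.

Let degreeE t i (E : {fset 'I_m * nat}) : (finsupp t `<=` E)%fset ->
  degree t i = (\sum_(p <- E | p.1 == i) t p)%N.
Proof.
move=> tE; rewrite /degree !(big_mkcond (fun p => p.1 == i)) /=.
rewrite (big_fset_incl _ tE) // => p _ /fsfun_dflt ->; exact: if_same.
Qed.

Let degreeD s t i : degree (s + t) i = (degree s i + degree t i)%N.
Proof.
pose E := (finsupp s `|` finsupp t `|` finsupp (s + t)%R)%fset.
have Es : (finsupp s `<=` E)%fset by rewrite /E -fsetUA fsubsetUl.
have Et : (finsupp t `<=` E)%fset by rewrite /E fsetUAC fsubsetUr.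
have Est : (finsupp (s + t)%R `<=` E)%fset by rewrite /E fsubsetUr.
rewrite (degreeE _ Es) (degreeE _ Et) (degreeE _ Est).
by rewrite -big_split; apply: eq_bigr => p _; exact: finfamD.
Qed.

Let degree0 i : degree 0 i = 0%N.
Proof. by rewrite /degree big1 // => p _; exact: finfam0. Qed.

Let degree_gen i j i' : degree (gen i j) i' = (i == i').
Proof.
rewrite (@degreeE _ _ (fset1 (i, j))); last first.
  apply/fsubsetP => p; rewrite mem_finsupp inE finfam_deltaE.
  by case: (p =P (i, j)).
rewrite big_mkcond big_seq_fset1 /= finfam_deltaE eqxx.
by case: (i == i').
Qed.

Lemma free_representation (T : 'I_m -> 'B(H)) :
  (forall i j x, T i (T j x) = T j (T i x)) ->
  exists Tinf : Nfam m -> 'B(H),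
    representation Tinf /\ (forall i j x, Tinf (gen i j) x = T i x).
Proof.
move=> TC.
pose F (s : seq 'I_m) t : 'B(H) :=
  foldr (fun i A => op_comp (iter (degree t i) (op_comp (T i)) op_id) A)
    op_id s.
have itE i k x : iter k (op_comp (T i)) op_id x = iter k (T i) x.
  by elim: k => //= k ->.
have FS i s t x : F (i :: s) t x = iter (degree t i) (T i) (F s t x).
  by rewrite /= itE.
have TF i s t x : T i (F s t x) = F s t (T i x).
  elim: s => // j s IHs; rewrite !FS -IHs.
  by elim: (degree t j) => //= k <-; exact: TC.
exists (F (enum 'I_m)); split; first split.
- by move=> x; elim: (enum _) => // i s IHs; rewrite FS degree0.
- move=> s t; elim: (enum _) => // i l IHl x.
  rewrite !FS degreeD iterD IHl; congr iter.
  by elim: (degree t i) => //= k ->; exact: TF.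
move=> i j x; have := mem_enum 'I_m i; have := enum_uniq 'I_m.
elim: (enum _) => // i' s IHs; rewrite cons_uniq => /andP[i's us].
rewrite inE FS degree_gen; have [ii' _|ii' /= ins] := eqVneq i i'.
  subst i'; congr (T i _); move: i's.
  elim: s {IHs us} => // k s IHs; rewrite inE negb_or => /andP[ik /IHs h].
  by rewrite FS degree_gen (negbTE ik).
by rewrite IHs.
Qed.

End FreeRepresentation.

(* The inclusion of H in K is an isometric linear map J, and P is the
   orthogonal projection of K onto J(H). *)
Definition regular (R : realType) (H : hilbertType R) (m : nat)
    (S : Nfam m -> 'B(H)) :=
  exists (K : hilbertType R) (J : {linear H -> K}) (P : 'B(K))
         (U : Zfam m -> 'B(K)),
    [/\ forall x y, '[J x, J y] = '[x, y],
        orthogonal_projection (range J) P,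
        representation U,
        forall g, unitary (U g)
      & forall (g : Zfam m) (x : H),
          J (adj (S (neg_part g)) (S (pos_part g) x)) = P (U g (J x))].

(* Main.v *)
(* Put S = T^infty and Phi(g) = S(g_-)^* S(g_+).

   If S is regular then, for a finite set v of generators, the squared norm of
   sum_{u in v} (-1)^|u| U(-e_u) S(e_u) x in K, with u ranging over the subsets
   of v, is sum_u (-1)^|u| |S(e_u) x|^2: expanding it, the terms with a given
   union of the two subsets add up to one term. Taking n_i generators in row i
   gives the binomial sum.

   Conversely let D_p B (x, y) = B(x, y) - B(S(e_p) x, S(e_p) y) for a
   sesquilinear form B. The binomial sums are the iterated differences D of the
   inner product. If all iterated differences of B over a list of generators
   are nonnegative, then B(S((a-b)_+) x, S((a-b)_-) y) is a positive
   semidefinite kernel on pairs (a, x): by induction on the list, since along a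
   generator p it is a sum of such kernels for B and for D_p B in the remaining
   generators, evaluated at the vectors S(e_p)^(a_p - d) x. Hence Phi is
   positive definite, and its reproducing kernel space, made of functions
   Z^(m x infty) -> H on which the group acts by translations, is a dilation;
   the projection onto H is evaluation at 0. *)
From HB Require Import structures.
Require Import Defs.
From mathcomp Require Import all_boot all_order all_algebra finmap complex.
From mathcomp Require Import sesquilinear.
From mathcomp Require Import all_classical all_reals all_analysis.
From mathcomp Require Import ring lra zify.

Set Implicit Arguments.
Unset Strict Implicit.
Unset Printing Implicit Defensive.

Import Order.TTheory GRing.Theory Num.Theory Num.Def.
Import numFieldNormedType.Exports.

Local Open Scope classical_set_scope.
Local Open Scope complex_scope.
Local Open Scope ring_scope.

(** * Inner products and quadratic discriminants *)

Section InnerProduct.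
Context {R : realType} {H : hilbertType R}.
Implicit Types (x y z : H) (a : R[i]).

Lemma innerDl x y z : '[x + y, z] = '[x, z] + '[y, z].
Proof. exact: linearDl. Qed.

Lemma innerDr x y z : '[x, y + z] = '[x, y] + '[x, z].
Proof. exact: raddfD. Qed.

Lemma innerZl a x y : '[a *: x, y] = a * '[x, y].
Proof. exact: linearZl_LR. Qed.

Lemma innerZr a x y : '[x, a *: y] = a^* * '[x, y].
Proof. exact: linearZ. Qed.

Lemma innerBl x y z : '[x - y, z] = '[x, z] - '[y, z].
Proof. exact: linearBl. Qed.

Lemma innerBr x y z : '[x, y - z] = '[x, y] - '[x, z].
Proof. exact: raddfB. Qed.

Lemma inner_suml (I : Type) (s : seq I) (F : I -> H) y :
  '[\sum_(i <- s) F i, y] = \sum_(i <- s) '[F i, y].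
Proof.
by elim/big_rec2: _ => [|i u v _ <-]; [exact: linear0l | exact: innerDl].
Qed.

Definition rnorm x : R := complex.Re `|x|.

Lemma rnormE x : `|x| = (rnorm x)%:C.
Proof. by rewrite /rnorm RRe_real // normr_real. Qed.

Lemma rnorm_ge0 x : 0 <= rnorm x.
Proof. by rewrite -ler0c -rnormE. Qed.

Lemma Re_inner_norm x : complex.Re '[x, x] = rnorm x ^+ 2.
Proof. by rewrite inner_norm rnormE -rmorphXn. Qed.

End InnerProduct.

Lemma normcRe (R : realType) (a : R[i]) : `|a| = (complex.Re `|a|)%:C.
Proof. by rewrite RRe_real // normr_real. Qed.

Lemma normcJ (R : realType) (a : R[i]) : `|a^*| = `|a|.
Proof. by case: a => x y; rewrite !normc_def /= sqrrN. Qed.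

Lemma Re_conjc (R : realType) (a : R[i]) : complex.Re a^* = complex.Re a.
Proof. by case: a. Qed.

Lemma discriminant_le0 (F : realFieldType) (a b c : F) :
  (forall t, 0 <= a + 2 * t * c + t ^+ 2 * b) -> 0 <= b -> c ^+ 2 <= a * b.
Proof.
move=> h; rewrite le_eqVlt => /predU1P[b0|b0].
  subst b; rewrite mulr0; have [->|c0] := eqVneq c 0; first by rewrite expr0n.
  (* For [b = 0] the hypothesis is affine in [t], and this [t] gives it the value -1. *)
  have := h (- (a + 1) / (2 * c)); rewrite mulr0 addr0.
  rewrite (_ : a + _ = - 1); first by lra.
  by field.
(* The minimum point of the quadratic. *)
have := h (- c / b); rewrite (_ : a + _ + _ = (a * b - c ^+ 2) / b).
  by rewrite ler_pdivlMr // mul0r subr_ge0.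
by field; rewrite gt_eqF.
Qed.

(** * Reproducing kernel Hilbert spaces *)

(** [k g h] sends a vector placed at [g] to the value at [h] of its kernel function. The identity on
    the diagonal makes every evaluation a map of norm at most 1. *)
Record op_kernel (R : realType) (H : hilbertType R) (X : Type) := OpKernel {
  kernel_fun :> X -> X -> H -> H;
  kernelP : forall g h a x y,
    kernel_fun g h (a *: x + y) = a *: kernel_fun g h x + kernel_fun g h y;
  kernelC : forall g h x y, '[kernel_fun g h x, y] = '[x, kernel_fun h g y];
  kernel_diag : forall g x, kernel_fun g g x = x;
  kernel_ge0 : forall w : seq (X * H),
    0 <= \sum_(e <- w) \sum_(e' <- w) '[kernel_fun e.1 e'.1 e.2, e'.2]
}.

Section Pairing.
Context {R : realType} {H : hilbertType R} {X : Type}.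
Implicit Types (f g : X -> H) (v w : seq (X * H)) (a : R[i]).

(** For [f] in the space built below this is the inner product of [f] with [kspan k w]. It makes
    sense for arbitrary functions, so it can serve to define the space. *)
Definition pairing f w : R[i] := \sum_(e <- w) '[f e.1, e.2].

Definition wscale a w := [seq (e.1, a *: e.2) | e <- w].

Lemma pairing_scale f a w : pairing f (wscale a w) = a^* * pairing f w.
Proof.
by rewrite /pairing big_map mulr_sumr; apply: eq_bigr => e _; exact: innerZr.
Qed.

Lemma pairingD f g w : pairing (f + g) w = pairing f w + pairing g w.
Proof. by rewrite -big_split; apply: eq_bigr => e _; exact: innerDl. Qed.

Lemma pairingZ a f w : pairing (a *: f) w = a * pairing f w.
Proof. by rewrite mulr_sumr; apply: eq_bigr => e _; exact: innerZl. Qed.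

Lemma pairingB f g w : pairing (f - g) w = pairing f w - pairing g w.
Proof. by rewrite pairingD -scaleN1r pairingZ mulN1r. Qed.

End Pairing.

Section RKHS.
Context {R : realType} {H : hilbertType R} {X : Type}.
Variable k : op_kernel H X.
Implicit Types (f g : X -> H) (v w : seq (X * H)) (a : R[i]) (c : R).

Definition kspan w : X -> H := fun h => \sum_(e <- w) k e.1 h e.2.

Lemma kernelZ s t a x : k s t (a *: x) = a *: k s t x.
Proof.
have k0 : k s t 0 = 0.
  by have := kernelP k s t (-1) 0 0; rewrite scaler0 add0r scaleN1r addNr.
by have := kernelP k s t a x 0; rewrite !addr0 k0 addr0.
Qed.

Lemma kspan_cat v w : kspan (v ++ w) = kspan v + kspan w.
Proof. by apply/funext => h; rewrite /kspan big_cat. Qed.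

Lemma kspan_scale a w : kspan (wscale a w) = a *: kspan w.
Proof.
apply/funext => h; rewrite /kspan big_map.
have -> : (a *: (fun h : X => \sum_(e <- w) k e.1 h e.2)) h =
  a *: (\sum_(e <- w) k e.1 h e.2) by [].
by rewrite scaler_sumr; apply: eq_bigr => e _; exact: kernelZ.
Qed.

Lemma pairing_kspan v w :
  pairing (kspan v) w = \sum_(e <- v) \sum_(e' <- w) '[k e.1 e'.1 e.2, e'.2].
Proof.
by rewrite exchange_big; apply: eq_bigr => e _; exact: inner_suml.
Qed.

Lemma pairing_kspanC v w : pairing (kspan w) v = (pairing (kspan v) w)^*.
Proof.
rewrite !pairing_kspan exchange_big rmorph_sum; apply: eq_bigr => e _ /=.
rewrite rmorph_sum; apply: eq_bigr => e' _ /=.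
by rewrite kernelC innerC.
Qed.

Definition rdot0 v w : R := complex.Re (pairing (kspan v) w).
Definition snorm w : R := Num.sqrt (rdot0 w w).

Lemma rdot0C v w : rdot0 v w = rdot0 w v.
Proof. by rewrite /rdot0 (pairing_kspanC v w) Re_conjc. Qed.

Lemma rdot0_ge0 w : 0 <= rdot0 w w.
Proof.
by have := kernel_ge0 k w; rewrite -pairing_kspan lecE => /andP[].
Qed.

Lemma snorm_ge0 w : 0 <= snorm w. Proof. exact: sqrtr_ge0. Qed.

Lemma snorm_sqr w : snorm w ^+ 2 = rdot0 w w.
Proof. by rewrite sqr_sqrtr // rdot0_ge0. Qed.

Lemma rdot0Dl u v w : rdot0 (u ++ v) w = rdot0 u w + rdot0 v w.
Proof. by rewrite /rdot0 kspan_cat pairingD raddfD. Qed.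

Lemma rdot0Dr u v w : rdot0 w (u ++ v) = rdot0 w u + rdot0 w v.
Proof. by rewrite rdot0C rdot0Dl !(rdot0C w). Qed.

Lemma rdot0Zl c v w : rdot0 (wscale c%:C v) w = c * rdot0 v w.
Proof.
rewrite /rdot0 kspan_scale pairingZ.
by case: (pairing _ _) => r s /=; rewrite mul0r subr0.
Qed.

Lemma rdot0Zr c v w : rdot0 w (wscale c%:C v) = c * rdot0 w v.
Proof. by rewrite rdot0C rdot0Zl rdot0C. Qed.

(** Cauchy-Schwarz for a possibly degenerate form: [rdot0] of [v + t w] with itself is a nonnegative
    quadratic in the real [t]. *)
Lemma rdot0_le v w : `|rdot0 v w| <= snorm v * snorm w.
Proof.
rewrite -(@ler_pXn2r _ 2) ?nnegrE ?mulr_ge0 ?snorm_ge0 ?normr_ge0 //.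
rewrite exprMn !snorm_sqr real_normK ?num_real //.
apply: discriminant_le0 (rdot0_ge0 _) => t.
have := rdot0_ge0 (v ++ wscale t%:C w).
rewrite !(rdot0Dl, rdot0Dr, rdot0Zl, rdot0Zr) (rdot0C w v); lra.
Qed.

Lemma snorm_scale a w : snorm (wscale a w) = complex.Re `|a| * snorm w.
Proof.
apply/eqP; rewrite -(@eqrXn2 _ 2) ?mulr_ge0 ?snorm_ge0 //; last first.
  by rewrite -ler0c RRe_real ?normr_real.
rewrite exprMn !snorm_sqr /rdot0 kspan_scale pairingZ pairing_scale mulrA.
have -> : a * a^* = (complex.Re `|a| ^+ 2)%:C.
  by rewrite -[LHS]normCK normcRe -rmorphXn.
by case: (pairing _ _) => r s /=; rewrite mul0r subr0.
Qed.

(** The real part suffices: a unimodular multiple of [w] rotates [pairing f w] arbitrarily and keeps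
    [snorm k w]. *)
Definition bounded_by c f :=
  forall w, `|complex.Re (pairing f w)| <= c * snorm w.

Lemma bounded_byD c d f g :
  bounded_by c f -> bounded_by d g -> bounded_by (c + d) (f + g).
Proof.
move=> fc gd w; rewrite pairingD raddfD mulrDl.
exact: le_trans (ler_normD _ _) (lerD (fc w) (gd w)).
Qed.

Lemma bounded_byZ a c f :
  bounded_by c f -> bounded_by (complex.Re `|a| * c) (a *: f).
Proof.
move=> fc w; rewrite pairingZ -[a in a * _]conjcK -pairing_scale.
apply: le_trans (fc _) _.
by rewrite snorm_scale normcJ mulrCA mulrA.
Qed.

Lemma bounded_by_kspan w : bounded_by (snorm w) (kspan w).
Proof. by move=> v; exact: rdot0_le. Qed.

Lemma bounded_by_le c d f : c <= d -> bounded_by c f -> bounded_by d f.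
Proof.
move=> cd fc w; apply: le_trans (fc w) _.
by rewrite ler_wpM2r ?snorm_ge0.
Qed.

(** Test on the vector [f x] placed at [x]: its pairing with [f] is the squared norm of [f x], and
    by [kernel_diag] its [snorm] is the norm of [f x]. *)
Lemma bounded_by_eval c f x : 0 <= c -> bounded_by c f -> rnorm (f x) <= c.
Proof.
move=> c0 /(_ [:: (x, f x)]).
rewrite /snorm /rdot0 /pairing /kspan !big_seq1 /= kernel_diag Re_inner_norm.
rewrite sqrtr_sqr !ger0_norm ?sqr_ge0 ?rnorm_ge0 //.
have := rnorm_ge0 (f x); rewrite le_eqVlt => /predU1P[<- //|f0].
by rewrite expr2 ler_pM2r.
Qed.

End RKHS.

(** * The norm and the underlying space of functions *)

Section FunctionNorm.
Context {R : realType} {H : hilbertType R} {X : Type}.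
Variable k : op_kernel H X.
Implicit Types (f g : X -> H) (v w : seq (X * H)) (a : R[i]) (c : R).

(* [fnorm f] is the norm of [f] as a functional on finite combinations [w]
   normed by [snorm]; it is [inf set0 = 0] when [f] is unbounded. *)
Definition bounds f := [set c | 0 <= c /\ bounded_by k c f].
Definition fnorm f : R := inf (bounds f).

Lemma fnorm_le c f : 0 <= c -> bounded_by k c f -> fnorm f <= c.
Proof. by move=> c0 fc; apply: ge_inf => //; exists 0 => d []. Qed.

Lemma fnorm_ge0 f : 0 <= fnorm f.
Proof.
rewrite /fnorm; have [->|/set0P b0] := eqVneq (bounds f) set0.
  by rewrite inf0.
by apply: lb_le_inf b0 _ => d [].
Qed.

(** For [w] of nonzero norm the condition on [c] is a closed half-line; for a null [w] any finite
    bound already forces the real part to vanish. *)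
Lemma fnormP f : bounds f !=set0 -> bounded_by k (fnorm f) f.
Proof.
move=> b0 w; have := snorm_ge0 k w; rewrite le_eqVlt => /predU1P[w0|w0].
  by have [c [_ /(_ w)]] := b0; rewrite -!w0 !mulr0.
rewrite -ler_pdivrMr //; apply: lb_le_inf b0 _ => c [_ fc].
by rewrite ler_pdivrMr.
Qed.

(* The closure of the functions [kspan k w] for [fnorm]: as a set of functions
   it needs neither a quotient by null vectors nor formal limits. *)
Definition approximable f :=
  forall e : R, 0 < e -> exists v, bounded_by k e (f - kspan k v).

Lemma approximable_bounds f : approximable f -> bounds f !=set0.
Proof.
move=> /(_ 1 ltr01) [v fv]; exists (1 + snorm k v); split.
  by rewrite addr_ge0 ?snorm_ge0.
rewrite -[f](subrK (kspan k v)).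
  exact: bounded_byD fv (bounded_by_kspan _ _).
Qed.

Lemma kspan0 : kspan k [::] = 0.
Proof. by apply/funext => h; rewrite /kspan big_nil. Qed.

Lemma approximable_kspan v : approximable (kspan k v).
Proof.
move=> e e0; exists v => w.
rewrite subrr -(scale0r 0) pairingZ mul0r normr0.
by rewrite mulr_ge0 ?snorm_ge0 // ltW.
Qed.

Definition rkhs_pred : {pred X -> H} := fun f => `[< approximable f >].

Lemma rkhs_closed : submod_closed rkhs_pred.
Proof.
split.
  by apply/asboolP; rewrite -kspan0; exact: approximable_kspan.
move=> a f g /asboolP fP /asboolP gP; apply/asboolP => e e0.
pose d := complex.Re `|a|.
have d0 : 0 <= d by rewrite -ler0c -normcRe.
(* The summand 1 in [d + 1] covers [a = 0]. *)
have [v fv] : exists v, bounded_by k (e / 2 / (d + 1)) (f - kspan k v).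
  by apply: fP; rewrite !divr_gt0 // ltr_wpDl.
have [w gw] : exists w, bounded_by k (e / 2) (g - kspan k w).
  by apply: gP; rewrite divr_gt0.
exists (wscale a v ++ w).
rewrite kspan_cat kspan_scale opprD addrACA -scalerBr.
apply: bounded_by_le _ (bounded_byD (bounded_byZ a fv) gw).
rewrite -/d [leRHS]splitr lerD2r.
rewrite mulrCA ler_piMr ?divr_ge0 ?(ltW e0) //.
by rewrite ler_pdivrMr ?ltr_wpDl // mul1r lerDl.
Qed.

End FunctionNorm.

HB.instance Definition _ (R : realType) (H : hilbertType R) (X : Type)
    (k : op_kernel H X) :=
  GRing.isSubmodClosed.Build R[i] (X -> H) (rkhs_pred k) (rkhs_closed k).

Record rkhs (R : realType) (H : hilbertType R) (X : Type) (k : op_kernel H X) :=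
  Rkhs { rkhs_fun :> X -> H; rkhs_funP : rkhs_fun \in rkhs_pred k }.

Section RkhsModule.
Context {R : realType} {H : hilbertType R} {X : Type} (k : op_kernel H X).

HB.instance Definition _ := [isSub for @rkhs_fun R H X k].
HB.instance Definition _ := gen_eqMixin (rkhs k).
HB.instance Definition _ := gen_choiceMixin (rkhs k).
HB.instance Definition _ := [SubChoice_isSubLmodule of rkhs k by <:].

End RkhsModule.

Section RkhsNorm.
Context {R : realType} {H : hilbertType R} {X : Type} {k : op_kernel H X}.
Implicit Types (f g : rkhs k) (a : R[i]).

Lemma rkhsP f : approximable k f. Proof. exact/asboolP/rkhs_funP. Qed.

Lemma rkhs_bounded f : bounded_by k (fnorm k f) f.
Proof. exact/fnormP/approximable_bounds/rkhsP. Qed.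

Definition rkhs_norm f : R[i] := (fnorm k f)%:C.

Lemma rkhs_fnormD f g : fnorm k (f + g) <= fnorm k f + fnorm k g.
Proof.
apply: fnorm_le; first by rewrite addr_ge0 ?fnorm_ge0.
exact: bounded_byD (rkhs_bounded f) (rkhs_bounded g).
Qed.

Lemma rkhs_fnormZ a f : fnorm k (a *: f) = complex.Re `|a| * fnorm k f.
Proof.
have n0 (b : R[i]) : 0 <= complex.Re `|b| by rewrite -ler0c -normcRe.
have le b g : fnorm k (b *: g) <= complex.Re `|b| * fnorm k g.
  apply: fnorm_le; first by rewrite mulr_ge0 ?fnorm_ge0.
  exact/bounded_byZ/rkhs_bounded.
have [->|a0] := eqVneq a 0.
  apply/eqP; rewrite eq_le le normr0 mul0r.
  exact: fnorm_ge0.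
apply/eqP; rewrite eq_le le /=.
(* The reverse inequality is the first one for the scalar [a^-1] and the vector [a *: f]. *)
have {1}-> : f = a^-1 *: (a *: f) by rewrite scalerK.
apply: le_trans (ler_wpM2l (n0 _) (le _ _)) _.
rewrite mulrA ler_piMl ?fnorm_ge0 //.
by rewrite -lecR rmorphM /= -!normcRe -normrM divff // normr1.
Qed.

Lemma rkhs_fnorm_eval f x : rnorm (f x) <= fnorm k f.
Proof. by apply: bounded_by_eval (fnorm_ge0 _ _) (rkhs_bounded _). Qed.

Lemma rkhs_normD f g : rkhs_norm (f + g) <= rkhs_norm f + rkhs_norm g.
Proof. by rewrite -rmorphD lecR rkhs_fnormD. Qed.

Lemma rkhs_normZ a f : rkhs_norm (a *: f) = `|a| * rkhs_norm f.
Proof. by rewrite /rkhs_norm rkhs_fnormZ rmorphM /= -normcRe. Qed.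

Lemma rkhs_norm_eq0 f : rkhs_norm f = 0 -> f = 0.
Proof.
move=> /(@complexI _ _ 0) f0; apply/val_inj/funext => x.
apply/eqP; rewrite -normr_eq0 rnormE; apply/eqP; congr (_%:C).
by apply/eqP; rewrite eq_le rnorm_ge0 andbT -f0 rkhs_fnorm_eval.
Qed.

HB.instance Definition _ := Lmodule_isNormed.Build R[i] (rkhs k)
  rkhs_normD rkhs_normZ rkhs_norm_eq0.

Lemma rkhs_normE f : `|f| = (fnorm k f)%:C. Proof. by []. Qed.

End RkhsNorm.

Lemma Re_inner_le (R : realType) (H : hilbertType R) (x y : H) :
  `|complex.Re '[x, y]| <= rnorm x * rnorm y.
Proof.
rewrite -(@ler_pXn2r _ 2) ?nnegrE ?mulr_ge0 ?rnorm_ge0 ?normr_ge0 //.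
rewrite exprMn -!Re_inner_norm real_normK ?num_real //.
apply: discriminant_le0 => [t|]; last by rewrite Re_inner_norm sqr_ge0.
have := sqr_ge0 (rnorm (x + t%:C *: y)).
rewrite -Re_inner_norm !(innerDl, innerDr, innerZl, innerZr) (innerC x y).
case: '[x, y] => r s; case: '[y, y] => r' s'; case: '[x, x] => r'' s'' /=.
lra.
Qed.

(** * The inner product of the reproducing kernel space *)

Section RkhsInner.
Context {R : realType} {H : hilbertType R} {X : Type} {k : op_kernel H X}.
Implicit Types (f g h : rkhs k) (a : R[i]).

Definition rspan w : rkhs k := Rkhs (asboolT (approximable_kspan k w)).

Lemma rspan_cat v w : rspan (v ++ w) = rspan v + rspan w.
Proof. exact/val_inj/kspan_cat. Qed.

Lemma rspan_scale a w : rspan (wscale a w) = a *: rspan w.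
Proof. exact/val_inj/kspan_scale. Qed.

(** Cauchy-Schwarz gives one inequality; testing the functional on [w] itself gives the other. *)
Lemma fnorm_rspan w : fnorm k (rspan w) = snorm k w.
Proof.
apply/eqP; rewrite eq_le fnorm_le ?snorm_ge0 //=; last exact: bounded_by_kspan.
have [w0|w0] := leP (snorm k w) 0; first exact: le_trans w0 (fnorm_ge0 _ _).
have := rkhs_bounded (rspan w) w.
by rewrite ger0_norm ?rdot0_ge0 // -/(rdot0 k w w) -snorm_sqr expr2 ler_pM2r.
Qed.

Lemma fnorm0 : fnorm k (0 : rkhs k) = 0.
Proof. by rewrite -(scale0r (0 : rkhs k)) rkhs_fnormZ normr0 mul0r. Qed.

Lemma fnormN f : fnorm k (- f) = fnorm k f.
Proof. by rewrite -scaleN1r rkhs_fnormZ normrN1 mul1r. Qed.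

Lemma fnormi f : fnorm k ('i%C *: f) = fnorm k f.
Proof.
by rewrite rkhs_fnormZ normc_def /= expr0n expr1n add0r sqrtr1 mul1r.
Qed.

Lemma fnorm_dist f g : `|fnorm k f - fnorm k g| <= fnorm k (f - g).
Proof.
have le (u v : rkhs k) : fnorm k u - fnorm k v <= fnorm k (u - v).
  by rewrite lerBlDr -{1}[u](subrK v); exact: rkhs_fnormD.
rewrite ler_norml lerNl opprB; apply/andP; split; last exact: le.
by rewrite -[leRHS]fnormN opprB le.
Qed.

Definition approximates (v : nat -> seq (X * H)) f :=
  fnorm k (f - rspan (v n)) @[n --> \oo] --> (0 : R).

Lemma approximatesE f : exists v, approximates v f.
Proof.
have e0 n : 0 < n.+1%:R^-1 :> R by rewrite invr_gt0.
have /choice[v vP] n : exists w, bounded_by k n.+1%:R^-1 (f - rspan w).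
  exact: rkhsP (e0 n).
exists v; apply/cvgrPdist_le => e e_gt0.
have := near_infty_natSinv_lt (PosNum e_gt0); apply: filterS => n /= ne.
rewrite sub0r normrN ger0_norm ?fnorm_ge0 //; apply: fnorm_le (ltW e_gt0) _.
exact: bounded_by_le (ltW ne) (vP n).
Qed.

Lemma approximatesD v w f g a : approximates v f -> approximates w g ->
  approximates (fun n => v n ++ wscale a (w n)) (f + a *: g).
Proof.
move=> vf wg.
apply: (@squeeze_cvgr _ _ _ _ (fun=> 0) (fun n => fnorm k (f - rspan (v n)) +
    complex.Re `|a| * fnorm k (g - rspan (w n)))).
- apply: nearW => n; rewrite fnorm_ge0 rspan_cat rspan_scale opprD addrACA.
  by rewrite -scalerBr -rkhs_fnormZ rkhs_fnormD.
- exact: cvg_cst.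
- rewrite -[X in _ --> X](addr0 0) -{2}(mulr0 (complex.Re `|a|)).
  by apply: cvgD => //; apply: cvgMr.
Qed.

Lemma approximates_norm v f : approximates v f ->
  snorm k (v n) @[n --> \oo] --> fnorm k f.
Proof.
move=> /cvgrPdist_le vf; apply/cvgrPdist_le => e e0.
have := vf e e0; apply: filterS => n; rewrite sub0r normrN.
rewrite ger0_norm ?fnorm_ge0 //; apply: le_trans.
by rewrite -fnorm_rspan fnorm_dist.
Qed.

(* The inner product is defined by polarization; it is bilinear as a limit of
   [rdot0] along approximating sequences. *)
Definition rdot f g : R := (fnorm k (f + g) ^+ 2 - fnorm k (f - g) ^+ 2) / 4.

Lemma rdot0_polar v w : rdot0 k v w =
  (snorm k (v ++ wscale 1 w) ^+ 2 - snorm k (v ++ wscale (- 1) w) ^+ 2) / 4.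
Proof.
have -> : wscale (- 1) w = wscale (- 1)%:C w by rewrite rmorphN.
rewrite (_ : wscale 1 w = wscale 1%:C w) //.
rewrite !snorm_sqr !(rdot0Dl, rdot0Dr, rdot0Zl, rdot0Zr) (rdot0C _ w v); lra.
Qed.

Lemma rdot_lim v w f g : approximates v f -> approximates w g ->
  rdot0 k (v n) (w n) @[n --> \oo] --> rdot f g.
Proof.
move=> vf wg; under eq_fun do rewrite rdot0_polar.
rewrite /rdot -[X in f + X]scale1r -[- g]scaleN1r.
have cvg2 (u : nat -> R) (l : R) : u n @[n --> \oo] --> l ->
    u n ^+ 2 @[n --> \oo] --> l ^+ 2 by move=> ul; exact: cvgM.
apply: cvgMl; apply: cvgB; apply/cvg2/approximates_norm/approximatesD => //.
Qed.

Lemma rdotC f g : rdot f g = rdot g f.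
Proof. by rewrite /rdot (addrC f) -(opprB g f) fnormN. Qed.

Lemma rdot_linear (c : R) f g h :
  rdot (f + c%:C *: g) h = rdot f h + c * rdot g h.
Proof.
have [u uf] := approximatesE f; have [v vg] := approximatesE g.
have [w wh] := approximatesE h.
have := rdot_lim (approximatesD c%:C uf vg) wh.
under eq_fun do rewrite rdot0Dl rdot0Zl.
move=> /(cvg_unique _); apply => //.
by apply: cvgD; [exact: rdot_lim|apply: cvgMr; exact: rdot_lim].
Qed.

(** Multiplying by i the vectors inside the two norms of the polarization formula keeps the norms
    and, as i squared is -1, swaps sum and difference. *)
Lemma rdoti f g : rdot ('i%C *: f) g = - rdot f ('i%C *: g).
Proof.
rewrite /rdot -[RHS]mulNr opprB; congr ((_ ^+ 2 - _ ^+ 2) / _).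
  rewrite -[LHS]fnormi scalerDr scalerA -expr2 sqr_i scaleN1r -fnormN.
  by rewrite opprD opprK.
by rewrite -[LHS]fnormi scalerBr scalerA -expr2 sqr_i scaleN1r -opprD fnormN.
Qed.

Lemma rdotii f g : rdot ('i%C *: f) ('i%C *: g) = rdot f g.
Proof. by rewrite /rdot -scalerDr -scalerBr !fnormi. Qed.

(** A form conjugate-linear in its second argument has as imaginary part at (f, g) its real part at
    (f, i g). *)
Definition hinner f g : R[i] := Complex (rdot f g) (rdot f ('i%C *: g)).

Lemma hinnerC f g : hinner f g = (hinner g f)^*.
Proof.
rewrite /hinner /= (rdotC g f); congr Complex.
by rewrite -[LHS]opprK -rdoti rdotC.
Qed.

Lemma hinnerDl f g h : hinner (f + g) h = hinner f h + hinner g h.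
Proof.
by rewrite /hinner -[g in LHS]scale1r !(rdot_linear 1) !mul1r.
Qed.

Lemma hinnerZl a f g : hinner (a *: f) g = a * hinner f g.
Proof.
have r0 h : rdot 0 h = 0 by rewrite /rdot add0r sub0r fnormN subrr mul0r.
have hZ c u h : rdot (c%:C *: u) h = c * rdot u h.
  by rewrite -[_ *: _]add0r rdot_linear r0 add0r.
have -> : a *: f = (complex.Re a)%:C *: f + (complex.Im a)%:C *: ('i%C *: f).
  rewrite scalerA -scalerDl; congr (_ *: _).
  by rewrite mulrC; exact: complexE.
rewrite /hinner !rdot_linear !hZ rdotii rdoti.
case: a => r s; apply/eqP; rewrite eq_complex /=.
by apply/andP; split; apply/eqP; ring.
Qed.

Lemma hinner_norm f : hinner f f = `|f| ^+ 2.
Proof.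
rewrite /hinner rkhs_normE -rmorphXn /=; congr Complex.
  have -> : rdot f f = fnorm k (f + f) ^+ 2 / 4.
    by rewrite /rdot subrr fnorm0 expr0n subr0.
  rewrite -mulr2n -scaler_nat rkhs_fnormZ ger0_norm // exprMn.
  by rewrite raddfMn /=; lra.
have := rdoti f f; rewrite rdotC; lra.
Qed.

(** Both sides are the limit of [rdot0 k (v n) w] along a sequence [v] approximating [f]; on the
    right because [f - rspan (v n)] is bounded by its norm as a functional. *)
Lemma rdot_rspan f w : rdot f (rspan w) = complex.Re (pairing f w).
Proof.
have [v vf] := approximatesE f.
have w0 : approximates (fun=> w) (rspan w).
  rewrite /approximates subrr fnorm0.
  exact: cvg_cst.
have := rdot_lim vf w0 => /(cvg_unique _); apply => //.
apply/cvgrPdist_le => e e0.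
have c0 : 0 < snorm k w + 1 by rewrite ltr_wpDl ?snorm_ge0.
have /cvgrPdist_le/(_ (e / (snorm k w + 1))) := vf.
rewrite divr_gt0 // => /(_ isT); apply: filterS => n.
rewrite sub0r normrN ger0_norm ?fnorm_ge0 // => fe.
have := rkhs_bounded (f - rspan (v n)) w.
rewrite pairingB raddfB /= => /le_trans; apply.
rewrite -[leRHS](divfK (lt0r_neq0 c0)).
by rewrite ler_pM ?fnorm_ge0 ?snorm_ge0 // lerDl.
Qed.

Lemma hinner_rspan f w : hinner f (rspan w) = pairing f w.
Proof.
rewrite /hinner -rspan_scale !rdot_rspan pairing_scale.
by case: (pairing _ _) => r s /=; congr Complex; ring.
Qed.

End RkhsInner.

(** * Sesquilinearity and completeness *)

Section RkhsHilbert.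
Context {R : realType} {H : hilbertType R} {X : Type} {k : op_kernel H X}.
Implicit Types (f g h : rkhs k) (a : R[i]).

Lemma hinnerDr f g h : hinner h (f + g) = hinner h f + hinner h g.
Proof. by rewrite hinnerC (hinnerC h f) (hinnerC h g) hinnerDl rmorphD. Qed.

Lemma hinnerZr a f g : hinner f (a *: g) = a^* * hinner f g.
Proof. by rewrite hinnerC (hinnerC f g) hinnerZl rmorphM. Qed.

Lemma hinnerBl h : zmod_morphism ((@hinner R H X k)^~ h).
Proof. by move=> f g; rewrite hinnerDl -scaleN1r hinnerZl mulN1r. Qed.

Lemma hinnerBr h : zmod_morphism (@hinner R H X k h).
Proof.
by move=> f g; rewrite hinnerDr -scaleN1r hinnerZr rmorphN1 mulN1r.
Qed.

HB.instance Definition _ := isBilinear.Build R[i] (rkhs k) (rkhs k) R[i]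
  *%R (conjC \; *%R) (@hinner R H X k) hinnerBl hinnerBr
  (fun g a f => hinnerZl a f g) (fun f a g => hinnerZr a f g).

Lemma hinner_hermitian f g : hinner f g = (-1) ^+ false * conjC (hinner g f).
Proof. by rewrite expr0 mul1r hinnerC. Qed.

HB.instance Definition _ := isHermitianSesquilinear.Build R[i] (rkhs k)
  false conjC (@hinner R H X k) hinner_hermitian.

Lemma hinner_gt0 f : f != 0 -> 0 < hinner f f.
Proof. by move=> f0; rewrite hinner_norm exprn_gt0 // normr_gt0. Qed.

HB.instance Definition _ := isDotProduct.Build R[i] (rkhs k)
  (@hinner R H X k) hinner_gt0.

(** Pointwise convergence is enough because [w] is finite: each entry uses half of the remaining
    tolerance. *)
Lemma near_pairing (F : set_system (rkhs k)) (l : X -> H) :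
  Filter F -> (forall x, (fun f : rkhs k => f x) @ F --> l x) ->
  forall w (e : R), 0 < e ->
    \forall f \near F, `|complex.Re (pairing (l - (f : rkhs k)) w)| <= e.
Proof.
move=> FF Fl; elim=> [|[x y] w IHw] e e0.
  by apply: nearW => f; rewrite /pairing big_nil normr0 ltW.
have e2 : 0 < e / 2 by rewrite divr_gt0.
have y0 : 0 < rnorm y + 1 by rewrite ltr_wpDl ?rnorm_ge0.
have d0 : 0 < (e / 2 / (rnorm y + 1))%:C by rewrite ltcR divr_gt0.
have /cvgrPdist_le/(_ _ d0) := Fl x; have := IHw _ e2.
apply: filterS2 => f fw; rewrite rnormE lecR => fx.
rewrite /pairing big_cons raddfD [leRHS]splitr.
apply: le_trans (ler_normD _ _) (lerD _ fw).
apply: le_trans (Re_inner_le _ _) _.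
rewrite -[leRHS](divfK (lt0r_neq0 y0)).
by rewrite ler_pM ?rnorm_ge0 // lerDl.
Qed.

(** Evaluations are contractive, so a Cauchy filter converges pointwise to some [l] by completeness
    of [H]; the norm estimates then pass to [l] one [w] at a time. *)
Lemma rkhs_complete (F : set_system (rkhs k)) :
  ProperFilter F -> cauchy F -> cvg F.
Proof.
move=> FF /cauchyP Fc.
have near_F (e : R) : 0 < e -> exists g, F [set f | fnorm k (g - f) <= e].
  move=> e0; have [|g Fg] := Fc e%:C; first by rewrite ltcR.
  exists g; apply: filterS Fg => f; rewrite -ball_normE /= rkhs_normE ltcR.
  exact: ltW.
have /choice[l Fl] x : exists y : H, (fun f : rkhs k => f x) @ F --> y.
  apply/cvg_ex; apply: cauchy_cvg; apply/cauchyP => e e0.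
  have [g Fg] := Fc e e0; exists (g x).
  rewrite -[_ _]/(F [set f : rkhs k | ball (g x) e (f x)]).
  apply: filterS Fg => f /=.
  rewrite -!ball_normE /=; apply: le_lt_trans.
  by have := rkhs_fnorm_eval (g - f) x; rewrite -lecR -rnormE.
have lg g (e : R) : F [set f | fnorm k (g - f) <= e] ->
    bounded_by k e (l - g).
  move=> Fg w; apply/ler_addgt0Pr => d d0.
  have [f [gf lf]] := filter_ex (filterI Fg (near_pairing FF Fl w d0)).
  have -> : pairing (l - g) w =
      pairing (l - (f : rkhs k)) w - pairing (g - f : rkhs k) w.
    have -> : pairing (g - f : rkhs k) w = pairing g w - pairing f w.
      exact: pairingB.
    by rewrite !pairingB opprB addrA subrK.
  rewrite raddfB addrC /=.
  apply: le_trans (ler_normD _ _) (lerD _ lf); rewrite normrN.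
  apply: le_trans (rkhs_bounded (g - f) w) _.
  by rewrite ler_wpM2r ?snorm_ge0.
(* Some [g] of the space is within [e / 2] of [l], and a finite combination is within [e / 2] of
   [g]. *)
have lP : approximable k l.
  move=> e e0; have e2 : 0 < e / 2 by rewrite divr_gt0.
  have [g /lg lge] := near_F _ e2; have [v gv] := rkhsP g e2.
  by exists v; rewrite [e]splitr -(subrKA (g : X -> H)); exact: bounded_byD.
pose L : rkhs k := Rkhs (asboolT lP).
apply/cvg_ex; exists L; apply/cvgrPdist_le => e e0.
have eR : e = (complex.Re e)%:C by rewrite RRe_real // gtr0_real.
have e2 : 0 < complex.Re e / 2 by rewrite divr_gt0 // -ltcR -eR.
have [g Fg] := near_F _ e2; apply: filterS (Fg) => f /= gf.
have Lg : fnorm k (L - g) <= complex.Re e / 2.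
  by apply: fnorm_le (ltW e2) _; exact: lg.
rewrite eR rkhs_normE lecR [leRHS]splitr.
have := rkhs_fnormD (L - g) (g - f); rewrite subrKA => /le_trans; apply.
exact: lerD.
Qed.

HB.instance Definition _ := Uniform_isComplete.Build (rkhs k) rkhs_complete.

Lemma rkhs_inner_norm f :
  (@hinner R H X k : {dot rkhs k for (@conjC R[i])}) f f = `|f| ^+ 2.
Proof. exact: hinner_norm. Qed.

HB.instance Definition _ := NormedModule_isHilbert.Build R (rkhs k)
  rkhs_inner_norm.

Lemma inner_rspan f w : '[f, rspan w] = pairing f w.
Proof. exact: hinner_rspan. Qed.

End RkhsHilbert.

(** * Dilation of positive definite functions *)

Section Naimark.
Context {R : realType} {H : hilbertType R} {G : zmodType}.
Variable Phi : G -> H -> H.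
Hypothesis PhiP : forall g a x y, Phi g (a *: x + y) = a *: Phi g x + Phi g y.
Hypothesis Phi0 : forall x, Phi 0 x = x.
Hypothesis PhiC : forall g x y, '[Phi g x, y] = '[x, Phi (- g) y].
Hypothesis Phi_ge0 : forall w : seq (G * H),
  0 <= \sum_(e <- w) \sum_(e' <- w) '[Phi (e.1 - e'.1) e.2, e'.2].

Let k_diag g x : Phi (g - g) x = x. Proof. by rewrite subrr Phi0. Qed.

Let k_herm g h x y : '[Phi (g - h) x, y] = '[x, Phi (h - g) y].
Proof. by rewrite PhiC opprB. Qed.

Let k : op_kernel H G :=
  @OpKernel R H G (fun g h => Phi (g - h)) (fun g h => PhiP (g - h))
    k_herm k_diag Phi_ge0.

Let shift t (f : G -> H) : G -> H := fun s => f (s - t).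
Let wshift t (w : seq (G * H)) := [seq (e.1 + t, e.2) | e <- w].

Let kspan_shift t w : kspan k (wshift t w) = shift t (kspan k w).
Proof.
apply/funext => s; rewrite /shift /kspan big_map; apply: eq_bigr => e _ /=.
by rewrite opprB addrA.
Qed.

Let pairing_shift t f w : pairing (shift t f) w = pairing f (wshift (- t) w).
Proof. by rewrite /pairing big_map. Qed.

Let wshiftK t w : wshift (- t) (wshift t w) = w.
Proof.
rewrite /wshift -map_comp -[RHS]map_id; apply: eq_map => -[s x] /=.
by rewrite addrK.
Qed.

Let snorm_shift t w : snorm k (wshift t w) = snorm k w.
Proof. by rewrite /snorm /rdot0 kspan_shift pairing_shift wshiftK. Qed.

Let bounded_shift t c f : bounded_by k c f -> bounded_by k c (shift t f).
Proof. by move=> fc w; rewrite pairing_shift -(snorm_shift (- t) w). Qed.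

Let approximable_shift t f : approximable k f -> approximable k (shift t f).
Proof.
move=> fP e /fP[v fv]; exists (wshift t v); rewrite kspan_shift.
exact: bounded_shift fv.
Qed.

Let ushift t (f : rkhs k) : rkhs k :=
  Rkhs (asboolT (approximable_shift t (rkhsP f))).

Let ushift_linear t : linear (ushift t).
Proof. by move=> a f g; apply/val_inj/funext. Qed.

Let ushiftD s t f : ushift (s + t) f = ushift s (ushift t f).
Proof.
apply/val_inj/funext => u; rewrite /= /shift.
by rewrite opprD addrA.
Qed.

Let ushift0 f : ushift 0 f = f.
Proof. by apply/val_inj/funext => u; rewrite /= /shift subr0. Qed.

Let ushiftK t f : ushift (- t) (ushift t f) = f.
Proof. by rewrite -ushiftD addNr ushift0. Qed.

Let fnorm_ushift t (f : rkhs k) : fnorm k (ushift t f) = fnorm k f.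
Proof.
have le s (g : rkhs k) : fnorm k (ushift s g) <= fnorm k g.
  by apply: fnorm_le (fnorm_ge0 _ _) _; apply/bounded_shift/rkhs_bounded.
by apply/eqP; rewrite eq_le le -{1}(ushiftK t f) le.
Qed.

HB.instance Definition _ t := GRing.isLinear.Build R[i] (rkhs k) (rkhs k) *:%R
  (ushift t) (ushift_linear t).

Let ushift_bounded t :
  exists M : R[i], forall f : rkhs k, `|ushift t f| <= M * `|f|.
Proof. by exists 1 => f; rewrite mul1r !rkhs_normE fnorm_ushift. Qed.

Let U t : 'B(rkhs k) := BoundedOperator (ushift_bounded t).

(** Translation by [- t] preserves norms, so applying it inside the polarization formula moves the
    shift to the other argument; it commutes with i, which settles the imaginary part. *)
Let inner_ushift t (f g : rkhs k) : '[ushift t f, g] = '[f, ushift (- t) g].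
Proof.
have rdot_ushift (u v : rkhs k) : rdot (ushift t u) v = rdot u (ushift (- t) v).
  rewrite /rdot -(fnorm_ushift (- t) (ushift t u + v)).
  rewrite -(fnorm_ushift (- t) (ushift t u - v)).
  have -> : ushift (- t) (ushift t u + v) = u + ushift (- t) v.
    by rewrite -[in RHS](ushiftK t u); exact: raddfD.
  have -> : ushift (- t) (ushift t u - v) = u - ushift (- t) v.
    by rewrite -[in RHS](ushiftK t u); exact: raddfB.
  by [].
have innerE (u v : rkhs k) : '[u, v] = Complex (rdot u v) (rdot u ('i%C *: v)).
  by [].
by rewrite !innerE !rdot_ushift linearZ.
Qed.

Let J x : rkhs k := rspan [:: (0, x)].

Let JE x g : J x g = Phi (- g) x.
Proof. by rewrite /= /kspan big_seq1 /= sub0r. Qed.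

Let J_linear : linear J.
Proof.
move=> a x y; apply/val_inj/funext => g.
have : J (a *: x + y) g = a *: J x g + J y g by rewrite !JE PhiP.
exact.
Qed.

HB.instance Definition _ := GRing.isLinear.Build R[i] H (rkhs k) *:%R
  J J_linear.

Let inner_J f x : '[f, J x] = '[f 0, x].
Proof. by rewrite inner_rspan /pairing big_seq1. Qed.

Let J0 x : J x 0 = x. Proof. by rewrite JE oppr0 Phi0. Qed.

(* Since ['[f, J x] = '[f 0, x]], evaluation at 0 is the adjoint of [J]. *)
Let proj (f : rkhs k) : rkhs k := J (f 0).

Let proj_linear : linear proj.
Proof. by move=> a f g; rewrite /proj -linearP. Qed.

HB.instance Definition _ := GRing.isLinear.Build R[i] (rkhs k) (rkhs k) *:%R
  proj proj_linear.

Let rnorm_J x : `|J x| = `|x|.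
Proof.
apply/eqP; rewrite -(@eqrXn2 _ 2) ?normr_ge0 //.
by rewrite -!inner_norm inner_J J0.
Qed.

Let proj_bounded : exists M : R[i], forall f : rkhs k, `|proj f| <= M * `|f|.
Proof.
exists 1 => f; rewrite mul1r rnorm_J rnormE rkhs_normE lecR.
exact: rkhs_fnorm_eval.
Qed.

(** The value at 0 of the translate by [g] of [J x] is [J x (- g)], that is [Phi g x]. *)
Lemma naimark_dilation :
  exists (K : hilbertType R) (J : {linear H -> K}) (P : 'B(K)) (U : G -> 'B(K)),
    [/\ forall x y, '[J x, J y] = '[x, y],
        orthogonal_projection (range J) P,
        representation U,
        forall g, unitary (U g)
      & forall g x, J (Phi g x) = P (U g (J x))].
Proof.
exists (rkhs k), J, (BoundedOperator proj_bounded), U; split.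
- by move=> x y; rewrite inner_J J0.
- move=> f; split; first by exists (f 0).
  by move=> _ [y _ <-] /=; rewrite innerBl !inner_J J0 subrr.
- by split=> [f|s t f] /=; [exact: ushift0 | exact: ushiftD].
- move=> g f.
  have adjE h : adj (U g) h = ushift (- g) h.
    by apply: inner_inj => u; rewrite -adjP inner_ushift.
  by rewrite !adjE /=; split; rewrite -ushiftD ?addNr ?subrr ushift0.
- move=> g x; congr J.
  by rewrite -[ushift g _ 0]/(J x (0 - g)) JE sub0r opprK.
Qed.

End Naimark.

(** * Brehmer positivity *)

Section FormDifference.
Context {C : numDomainType} {V : zmodType}.
Implicit Types (B : V -> V -> C) (S T : V -> V) (x y z : V).

(** For the inner product this is the form of the defect operator 1 - T^* T. *)
Definition form_diff T B x y := B x y - B (T x) (T y).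

Lemma form_diffC S T B : (forall x, S (T x) = T (S x)) ->
  form_diff S (form_diff T B) = form_diff T (form_diff S B).
Proof.
move=> ST; apply/funext => x; apply/funext => y; rewrite /form_diff !ST; ring.
Qed.

Lemma iter_form_diffC n S T B : (forall x, S (T x) = T (S x)) ->
  form_diff S (iter n (form_diff T) B) = iter n (form_diff T) (form_diff S B).
Proof. by move=> ST; elim: n => //= n <-; exact: form_diffC. Qed.

Lemma iter_form_diffE n T B x y : iter n (form_diff T) B x y =
  \sum_(j < n.+1) (-1) ^+ j * 'C(n, j)%:R * B (iter j T x) (iter j T y).
Proof.
elim: n x y => [|n IHn] x y; first by rewrite big_ord1 expr0 bin0 !mul1r.
rewrite /= /form_diff !IHn [RHS]big_ord_recl /= expr0 bin0 !mul1r.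
pose q j := B (iter j T x) (iter j T y).
(* Pascal's rule needs the indices [j.+1] and [j] side by side: the term 0 is split off, and the
   added top term vanishes with its binomial coefficient. *)
have -> :
    \sum_(j < n.+1) (-1) ^+ j * 'C(n, j)%:R * B (iter j T x) (iter j T y) =
    q 0%N + \sum_(j < n.+1) (-1) ^+ j.+1 * 'C(n, j.+1)%:R * q j.+1.
  have <- : \sum_(j < n.+2) (-1) ^+ j * 'C(n, j)%:R * q j =
      \sum_(j < n.+1) (-1) ^+ j * 'C(n, j)%:R * q j.
    by rewrite big_ord_recr /= bin_small // mulr0 mul0r addr0.
  by rewrite big_ord_recl expr0 bin0 !mul1r.
rewrite -addrA; congr (_ + _); rewrite -sumrB; apply: eq_bigr => j _.
have -> : B (iter j T (T x)) (iter j T (T y)) = q j.+1 by rewrite /q !iterSr.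
rewrite -[B (T _) _]/(q j.+1) -[bump 0 j]/(j.+1).
by rewrite binS natrD exprS; ring.
Qed.

Definition biadditive B :=
  (forall x y z, B (x + y) z = B x z + B y z) /\
  (forall x y z, B x (y + z) = B x y + B x z).

Lemma biadditive_form_diff T B : {morph T : x y / x + y} ->
  biadditive B -> biadditive (form_diff T B).
Proof.
move=> TD [Bl Br]; rewrite /form_diff.
by split=> x y z; rewrite !TD !(Bl, Br) opprD addrACA.
Qed.

Lemma biadditive0 B : biadditive B ->
  (forall y, B 0 y = 0) /\ (forall x, B x 0 = 0).
Proof.
case=> Bl Br; split=> x.
  by apply: (addrI (B 0 x)); rewrite -Bl !addr0.
by apply: (addrI (B x 0)); rewrite -Br !addr0.
Qed.

Lemma biadditive_sum (I : Type) (s : seq I) (F : I -> V) B : biadditive B ->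
  \sum_(e <- s) \sum_(e' <- s) B (F e) (F e') =
  B (\sum_(e <- s) F e) (\sum_(e <- s) F e).
Proof.
move=> BP; have [B0l B0r] := biadditive0 BP; have [Bl Br] := BP.
rewrite (big_morph (B^~ _) (fun x y => Bl x y _) (B0l _)).
by apply: eq_bigr => e _; rewrite (big_morph (B _) (Br _) (B0r _)).
Qed.

Section Brehmer.
Context {P : Type} (A : P -> V -> V).
Hypothesis AC : forall p q x, A p (A q x) = A q (A p x).
Hypothesis AD : forall p, {morph A p : x y / x + y}.

(** Unfolded, this asks for nonnegativity of the iterated difference of [B] over every sublist of
    [ps]. *)
Fixpoint brehmer B (ps : seq P) : Prop :=
  if ps is p :: ps' then brehmer B ps' /\ brehmer (form_diff (A p) B) ps'
  else forall x, 0 <= B x x.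

(* The kernel (a, b) |-> S((a - b)_-)^* S((a - b)_+) of a semigroup
   representation, for nonnegative a and b and with the form B in place of the
   inner product; the subtractions are truncated. *)
Fixpoint brehmer_kernel B (ps : seq P) (a : P -> nat) x (b : P -> nat) y : C :=
  if ps is p :: ps' then
    brehmer_kernel B ps' a (iter (a p - b p) (A p) x)
                         b (iter (b p - a p) (A p) y)
  else B x y.

Lemma iter_comm p q n x : A p (iter n (A q) x) = iter n (A q) (A p x).
Proof. by elim: n => //= n <-. Qed.

Lemma brehmer_kernel_diff p B ps a x b y :
  brehmer_kernel (form_diff (A p) B) ps a x b y =
  brehmer_kernel B ps a x b y - brehmer_kernel B ps a (A p x) b (A p y).
Proof. by elim: ps x y => //= q ps IHps x y; rewrite IHps !iter_comm. Qed.

(* With [c := minn n m], iterating [K_B(u, v) = K_B'(u, v) + K_B(A p u, A p v)]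
   for [B' := form_diff (A p) B] moves [c] factors [A p] into both arguments. *)
Lemma brehmer_kernel_telescope p B ps a x b y n m N : (n <= N)%N ->
  brehmer_kernel B ps a (iter (n - m) (A p) x) b (iter (m - n) (A p) y) =
  brehmer_kernel B ps a (iter n (A p) x) b (iter m (A p) y) +
  \sum_(0 <= d < N | (d < n)%N && (d < m)%N)
    brehmer_kernel (form_diff (A p) B) ps
      a (iter (n - d.+1) (A p) x) b (iter (m - d.+1) (A p) y).
Proof.
move=> nN; pose f d :=
  brehmer_kernel B ps a (iter (n - d) (A p) x) b (iter (m - d) (A p) y).
have -> : \sum_(0 <= d < N | (d < n)%N && (d < m)%N)
    brehmer_kernel (form_diff (A p) B) ps
      a (iter (n - d.+1) (A p) x) b (iter (m - d.+1) (A p) y) =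
    \sum_(0 <= d < minn n m) (f d.+1 - f d).
  rewrite (@big_nat_widen _ _ _ 0 (minn n m) N) ?geq_min ?nN //.
  apply: eq_big => [d|d /andP[dn dm]]; first by rewrite leq_min.
  by rewrite brehmer_kernel_diff -!iterS -!subSn // !subSS.
rewrite telescope_sumr // /f !subn0 addrC subrK.
by congr (brehmer_kernel _ _ _ (iter _ _ _) _ (iter _ _ _)); lia.
Qed.

Lemma brehmer_kernel_ge0 B ps : biadditive B -> brehmer B ps ->
  forall w : seq ((P -> nat) * V),
  0 <= \sum_(e <- w) \sum_(e' <- w) brehmer_kernel B ps e.1 e.2 e'.1 e'.2.
Proof.
elim: ps B => [|p ps IHps] B BD /= => [B0 w|[B0 B1] w].
  by rewrite (biadditive_sum w snd BD).
(* A common range for the telescoping sums of all pairs. *)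
pose N := (\sum_(e <- w) e.1 p)%N.
have wN e : e \in [seq e.1 p | e <- w] -> (e <= N)%N.
  rewrite /N -(big_map (fun e => e.1 p) xpredT id) => /(big_rem _) /= ->.
  exact: leq_addr.
pose next := [seq (e.1, iter (e.1 p) (A p) e.2) | e <- w].
(* The condition that [d] is below both exponents splits into one condition per argument, so each
   [d] contributes a full double sum over a single list. *)
pose level d :=
  [seq (e.1, iter (e.1 p - d.+1) (A p) e.2) | e <- w & (d < e.1 p)%N].
rewrite (_ : \sum_(e <- w) _ =
  \sum_(e <- next) \sum_(e' <- next) brehmer_kernel B ps e.1 e.2 e'.1 e'.2 +
  \sum_(0 <= d < N) \sum_(e <- level d) \sum_(e' <- level d)
    brehmer_kernel (form_diff (A p) B) ps e.1 e.2 e'.1 e'.2).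
  rewrite addr_ge0 ?IHps // sumr_ge0 // => d _.
  by apply: IHps B1 _; exact: biadditive_form_diff.
have -> : \sum_(0 <= d < N) \sum_(e <- level d) \sum_(e' <- level d)
    brehmer_kernel (form_diff (A p) B) ps e.1 e.2 e'.1 e'.2 =
  \sum_(e <- w) \sum_(e' <- w)
    \sum_(0 <= d < N | (d < e.1 p)%N && (d < e'.1 p)%N)
      brehmer_kernel (form_diff (A p) B) ps
        e.1 (iter (e.1 p - d.+1) (A p) e.2)
        e'.1 (iter (e'.1 p - d.+1) (A p) e'.2).
  under eq_bigr do rewrite big_map big_filter big_mkcond.
  rewrite exchange_big; apply: eq_bigr => e _.
  under [RHS]eq_bigr do rewrite big_mkcond.
  rewrite [RHS]exchange_big; apply: eq_bigr => d _.
  case: ltnP => _ /=; last by rewrite big1.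
  by rewrite big_map big_filter big_mkcond.
rewrite big_map -big_split.
rewrite [LHS]big_seq [RHS]big_seq; apply: eq_bigr => e ew.
rewrite big_map -big_split; apply: eq_bigr => e' _ /=.
by apply: brehmer_kernel_telescope; apply/wN/map_f.
Qed.

End Brehmer.
End FormDifference.

(** * Finitely supported families and their positive parts *)

Section FinFamily.
Context {K : choiceType}.
Implicit Types (g h : finfam K int) (ps : seq K) (p q : K).

Lemma finfam_sumE (V : nmodType) (I : Type) (s : seq I)
    (F : I -> finfam K V) q :
  (\sum_(i <- s) F i) q = \sum_(i <- s) F i q.
Proof.
by elim/big_rec2: _ => [|i x t _ <-]; [exact: finfam0 | exact: finfamD].
Qed.

Lemma finfam_mulrnE (V : nmodType) (t : finfam K V) n q : (t *+ n) q = t q *+ n.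
Proof. by elim: n => [|n IHn]; rewrite ?finfam0 // !mulrS finfamD IHn. Qed.

Lemma finfamN g q : (- g) q = - g q.
Proof. exact: finfam_oppE. Qed.

Lemma finfam_sum_delta (t : finfam K nat) ps (c : K -> nat) : uniq ps ->
  (forall q, t q = if q \in ps then c q else 0%N) ->
  t = \sum_(p <- ps) finfam_delta p *+ c p.
Proof.
move=> us tE; apply/fsfunP => q; rewrite tE finfam_sumE.
have E p : (finfam_delta p *+ c p) q = if p == q then c p else 0%N.
  rewrite finfam_mulrnE finfam_deltaE eq_sym.
  by case: eqP => _; rewrite ?mul0rn // -mulr_natr mul1r natn.
rewrite (eq_bigr _ (fun p _ => E p)); case: ifPn => [qs|qs].
  rewrite (bigD1_seq q) //= eqxx big1 ?addr0 // => p /negbTE -> //.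
by rewrite big_seq big1 // => p ps'; case: eqP => // pq; rewrite -pq ps' in qs.
Qed.

Lemma neg_partN g : neg_part g = pos_part (- g).
Proof.
by apply/fsfunP => q; apply/eqP; rewrite -eqz_nat neg_partE pos_partE finfamN.
Qed.

(* [a] and [b] are [g] and [h] translated into the nonnegative families. *)
Lemma pos_part_sum g h ps (M : nat) (a b : K -> nat) : uniq ps ->
  (forall p, p \notin ps -> g p = 0 /\ h p = 0) ->
  (forall p, p \in ps -> (a p)%:Z = g p + M%:Z /\ (b p)%:Z = h p + M%:Z) ->
  pos_part (g - h) = \sum_(p <- ps) finfam_delta p *+ (a p - b p)%N.
Proof.
move=> us gh0 abE; apply: finfam_sum_delta us _ => q; apply/eqP.
rewrite -eqz_nat pos_partE finfamD finfamN; case: ifPn => qs.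
  have [] := abE q qs; move: (g q) (h q) => u v; lia.
by have [-> ->] := gh0 q qs; rewrite subrr maxxx.
Qed.

End FinFamily.

(** * Positive definiteness of Phi and the regular dilation *)

Section Regular.
Context {R : realType} {H : hilbertType R} {K : choiceType}.
Variable S : finfam K nat -> 'B(H).
Hypothesis SR : representation S.
Implicit Types (x y : H) (g h : finfam K int).

Let A (p : K) : H -> H := S (finfam_delta p).
Let B (x y : H) : R[i] := '[x, y].

Lemma rep_mulrn t n x : S (t *+ n) x = iter n (S t) x.
Proof. by elim: n => [|n IHn]; rewrite ?SR.1 // mulrS SR.2 IHn. Qed.

Lemma rep_comm s t x : S s (S t x) = S t (S s x).
Proof. by rewrite -!SR.2 addrC. Qed.

Lemma brehmer_kernel_rep ps a x b y : brehmer_kernel A B ps a x b y =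
  '[S (\sum_(p <- ps) finfam_delta p *+ (a p - b p)%N) x,
    S (\sum_(p <- ps) finfam_delta p *+ (b p - a p)%N) y].
Proof.
elim: ps x y => [|p ps IHps] x y; first by rewrite !big_nil !SR.1.
rewrite /= IHps !big_cons -!rep_mulrn -!SR.2.
rewrite (addrC (finfam_delta p *+ _)).
by rewrite (addrC (finfam_delta p *+ (b p - _)%N)).
Qed.

Lemma adj_linear (T : 'B(H)) a x y :
  adj T (a *: x + y) = a *: adj T x + adj T y.
Proof. by apply: inner_inj => z; rewrite -adjP !(innerDr, innerZr) -!adjP. Qed.

Definition toeplitz g x : H := adj (S (neg_part g)) (S (pos_part g) x).

Lemma inner_toeplitz g x y :
  '[toeplitz g x, y] = '[S (pos_part g) x, S (neg_part g) y].
Proof. by rewrite innerC -adjP -innerC. Qed.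

Lemma toeplitz_linear g a x y :
  toeplitz g (a *: x + y) = a *: toeplitz g x + toeplitz g y.
Proof. by rewrite /toeplitz linearP adj_linear. Qed.

Lemma pos_part0 : pos_part (0 : finfam K int) = 0.
Proof.
by apply/fsfunP => q; apply/eqP; rewrite -eqz_nat pos_partE !finfam0 maxxx.
Qed.

Lemma toeplitz0 x : toeplitz 0 x = x.
Proof.
apply: inner_inj => y; rewrite innerC inner_toeplitz neg_partN oppr0 pos_part0.
by rewrite !SR.1 -innerC.
Qed.

Lemma toeplitzC g x y : '[toeplitz g x, y] = '[x, toeplitz (- g) y].
Proof.
by rewrite inner_toeplitz adjP /toeplitz (neg_partN (- g)) opprK -neg_partN.
Qed.

Hypothesis brehmerS : forall ps : seq K, uniq ps -> brehmer A B ps.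

Lemma toeplitz_ge0 (w : seq (finfam K int * H)) :
  0 <= \sum_(e <- w) \sum_(e' <- w) '[toeplitz (e.1 - e'.1) e.2, e'.2].
Proof.
pose ps := undup (flatten [seq (finsupp e.1 : seq K) | e <- w]).
have ps_uniq : uniq ps by exact: undup_uniq.
have ps0 e p : e \in w -> p \notin ps -> e.1 p = 0.
  move=> ew; rewrite mem_undup; apply: contraNeq => ep.
  apply/flattenP; exists (finsupp e.1 : seq K); first exact: map_f.
  by rewrite mem_finsupp.
(* [M] bounds all entries in absolute value: adding it on [ps] makes the families nonnegative there
   and keeps their differences. *)
pose M := (\sum_(e <- w) \sum_(p <- ps) `|e.1 p|)%N.
have psM e p : e \in w -> p \in ps -> (`|e.1 p| <= M)%N.
  move=> ew pps; rewrite /M (big_rem e) //= (big_rem p) //=.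
  by rewrite -addnA leq_addr.
pose a (g : finfam K int) p := absz (g p + M%:Z).
have aE e p : e \in w -> p \in ps -> (a e.1 p)%:Z = e.1 p + M%:Z.
  by move=> ew pps; have := psM e p ew pps; rewrite /a; lia.
have AC p q x : A p (A q x) = A q (A p x) by exact: rep_comm.
have AD p : {morph A p : x y / x + y} by exact: linearD.
have BD : biadditive B by split=> x y z; [exact: innerDl | exact: innerDr].
have := brehmer_kernel_ge0 AC AD BD (brehmerS ps_uniq)
  [seq (a e.1, e.2) | e <- w].
rewrite big_map; congr (0 <= _).
rewrite [LHS]big_seq [RHS]big_seq; apply: eq_bigr => e ew.
rewrite big_map [LHS]big_seq [RHS]big_seq; apply: eq_bigr => e' e'w.
rewrite brehmer_kernel_rep inner_toeplitz neg_partN opprB /=.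
rewrite (@pos_part_sum _ e.1 e'.1 ps M (a e.1) (a e'.1)) //; try by split; auto.
by rewrite (@pos_part_sum _ e'.1 e.1 ps M (a e'.1) (a e.1)) //; split; auto.
Qed.

Theorem brehmer_regular :
  exists (L : hilbertType R) (J : {linear H -> L}) (P : 'B(L))
         (U : finfam K int -> 'B(L)),
    [/\ forall x y, '[J x, J y] = '[x, y],
        orthogonal_projection (range J) P,
        representation U,
        forall g, unitary (U g)
      & forall g x,
          J (adj (S (neg_part g)) (S (pos_part g) x)) = P (U g (J x))].
Proof.
exact: (naimark_dilation toeplitz_linear toeplitz0 toeplitzC toeplitz_ge0).
Qed.

End Regular.

(** * Binomial expansion of the defect forms *)

(** Used to read the product over [rev_ord i], in which the first operator acts first, as a product
    over the reversed list of indices. *)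
Lemma map_rev_index_enum m :
  [seq rev_ord i | i <- index_enum 'I_m] = rev (index_enum 'I_m).
Proof.
have -> : index_enum 'I_m = enum 'I_m by rewrite enumT.
apply: (inj_map val_inj); rewrite map_rev val_enum_ord -map_comp.
rewrite (eq_map (g := (fun j => m - j.+1)%N \o val)) // map_comp val_enum_ord.
apply: (@eq_from_nth _ 0%N) => [|i]; rewrite size_map ?size_rev //.
rewrite size_iota => im.
rewrite (nth_map 0%N) ?nth_rev ?size_iota // !nth_iota //; lia.
Qed.

Section Defect.
Context {R : realType} {H : hilbertType R} {m : nat}.
Variable T : 'I_m -> 'B(H).
Hypothesis TC : forall i j x, T i (T j x) = T j (T i x).
Implicit Types (n : 'I_m -> nat) (s : seq 'I_m) (x y : H).

Let B0 (x y : H) : R[i] := '[x, y].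

Definition defect n s : H -> H -> R[i] :=
  foldr (fun i => iter (n i) (form_diff (T i))) B0 s.

Lemma eq_defect n n' s : {in s, n =1 n'} -> defect n s = defect n' s.
Proof.
elim: s => //= i s IHs nn'; rewrite nn' ?inE ?eqxx // IHs // => j js.
by apply: nn'; rewrite inE js orbT.
Qed.

Lemma defect_succ n s i : uniq s -> i \in s ->
  form_diff (T i) (defect n s) = defect (fun j => n j + (j == i))%N s.
Proof.
elim: s => //= j s IHs /andP[js us]; rewrite inE eq_sym.
have [<- _|ij /= /(IHs us) <-] := eqVneq j i.
  rewrite addn1 /= (@eq_defect _ n s) // => l ls.
  by rewrite (negbTE (memPn js l ls)) addn0.
by rewrite addn0 iter_form_diffC.
Qed.

(** Each difference along [p] raises the multiplicity of row [f p] by one, so every iterated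
    difference over a sublist is again a [defect]; repeated rows accumulate. *)
Lemma defect_brehmer (K : Type) (f : K -> 'I_m) :
  (forall n x, 0 <= defect n (index_enum 'I_m) x x) ->
  forall ps, brehmer (fun p => T (f p)) B0 ps.
Proof.
move=> pos ps.
have -> : B0 = defect (fun=> 0%N) (index_enum 'I_m) by elim: (index_enum _).
elim: ps (fun=> 0%N) => [|p ps IHps] n //=; split; first exact: IHps.
by rewrite defect_succ ?index_enum_uniq ?mem_index_enum.
Qed.

Section Expansion.
Variable n : 'I_m -> nat.
Notation multi := {dffun forall i : 'I_m, 'I_(n i).+1}.
Implicit Types k : multi.

Let c i (j : nat) : R[i] := (-1) ^+ j * 'C(n i, j)%:R.
Let Tpow k s x := foldl (fun z i => iter (k i) (T i) z) x s.

Let upd k i (j : 'I_(n i).+1) : multi :=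
  [ffun l => @dfwith _ (fun l => 'I_(n l).+1) (fun l => k l) i j l].

Let upd_in k i j : upd k j i = j :> 'I_(n i).+1.
Proof. by rewrite ffunE dfwithin. Qed.

Let upd_out k i (j : 'I_(n i).+1) l : l != i -> upd k j l = k l.
Proof. by move=> li; rewrite ffunE dfwithout // eq_sym. Qed.

(** Multi-indices are required to vanish outside [s], so that the induction on [s] sums over one
    fixed type. *)
Lemma defect_expansion s x y : uniq s ->
  defect n s x y =
  \sum_(k : multi | [forall i, (i \notin s) ==> (k i == ord0)])
    (\prod_(i <- s) c i (k i)) * '[Tpow k s x, Tpow k s y].
Proof.
elim: s x y => [|i s IHs] x y /=.
  rewrite (big_pred1 ([ffun=> ord0] : multi)) ?big_nil ?mul1r // => k /=.
  apply/forallP/eqP => [k0|-> i]; last by rewrite ffunE.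
  by apply/ffunP => i; rewrite ffunE; apply/eqP/k0.
case/andP=> si us; rewrite iter_form_diffE.
rewrite [RHS](partition_big (fun k : multi => k i) xpredT) //=.
apply: eq_bigr => j _; rewrite IHs // mulr_sumr.
(* Changing the coordinate [i] matches the multi-indices with value [j] there with those vanishing
   there. *)
rewrite [RHS](reindex_onto (fun k => upd k j) (fun k => @upd k i ord0)) /=;
  last first.
  move=> k /andP[_ /eqP kj]; apply/ffunP => l; have [->|li] := eqVneq l i.
    by rewrite upd_in kj.
  by rewrite !upd_out.
have sE k l : l \in s -> upd k j l = k l.
  by move=> ls; rewrite upd_out //; apply: contraNneq si => <-.
apply: eq_big => [k|k _].
  apply/forallP/andP => [k0|[/andP[/forallP k0 _] /eqP kE] l].
    split; last first.
      apply/eqP/ffunP => l.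
      have [->|li] := eqVneq l i; last by rewrite !upd_out.
      by rewrite upd_in; apply/esym/eqP; have := k0 i; rewrite si.
    rewrite upd_in eqxx andbT; apply/forallP => l; apply/implyP.
    rewrite inE negb_or => /andP[li ls]; rewrite upd_out //.
    by have := k0 l; rewrite ls.
  apply/implyP => ls; have [li|li] := eqVneq l i.
    by subst l; rewrite -kE upd_in.
  by have := k0 l; rewrite inE negb_or li ls upd_out.
rewrite big_cons upd_in -!mulrA; congr (_ * (_ * _)).
have powE z : Tpow (upd k j) s z = Tpow k s z.
  rewrite /Tpow; elim: s z {IHs us si} sE => //= l s IHs z sE.
  rewrite sE ?inE ?eqxx // IHs // => k' l' ls.
  by apply: sE; rewrite inE ls orbT.
rewrite !powE; congr (_ * _).
by rewrite big_seq [RHS]big_seq; apply: eq_bigr => l ls; rewrite sE.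
Qed.

Let bigcompE (F : 'I_m -> H -> H) s x :
  (\big[comp/id]_(i <- s) F i) x = foldr (fun i z => F i z) x s.
Proof. by elim: s x => [|i s IHs] x; rewrite ?big_nil // big_cons /= IHs. Qed.

(** Moving the adjoints to the second argument turns each term into a squared norm of a product of
    powers applied to [x]. *)
Lemma defect_sum x :
  '[(\sum_(k : multi)
       (((-1) ^+ (\sum_(i < m) k i)%N * \prod_(i < m) ('C(n i, k i))%:R : R[i])
        *: ((\big[comp/id]_(i < m) iter (k i) (adj (T i)))
            \o (\big[comp/id]_(i < m) iter (k (rev_ord i)) (T (rev_ord i))))
        : H -> H)) x, x] =
  defect n (index_enum 'I_m) x x.
Proof.
rewrite (@defect_expansion _ _ _ (index_enum_uniq _)) fct_sumE inner_suml.
apply: eq_big => [k|k _].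
  by apply/esym/forallP => i; rewrite mem_index_enum.
rewrite [X in '[X, _]]/(_ *: _) /= innerZl; congr (_ * _).
  rewrite /c big_split /=; congr (_ * _).
  by elim/big_rec2: _ => // i u v _ <-; rewrite exprD.
have adjE s z u : '[foldr (fun i => iter (k i) (adj (T i))) z s, u] =
    '[z, foldl (fun z i => iter (k i) (T i) z) u s].
  elim: s u => //= i s IHs u; rewrite -IHs.
  elim: (k i : nat) u => //= j IHj u.
  by rewrite innerC -adjP -innerC IHj -iterSr.
rewrite !bigcompE adjE; congr '[_, _].
rewrite /Tpow -[X in foldl _ _ X]revK foldl_rev -map_rev_index_enum.
by rewrite foldr_map.
Qed.

End Expansion.
End Defect.

(** * Positivity of the defects of a regular representation *)

Section RegularDefect.
Context {R : realType} {H L : hilbertType R} {K : choiceType}.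
Variables (S : finfam K nat -> 'B(H)) (J : {linear H -> L}) (P : 'B(L)).
Variable U : finfam K int -> 'B(L).
Hypothesis SR : representation S.
Hypothesis J_isometry : forall x y, '[J x, J y] = '[x, y].
Hypothesis P_proj : orthogonal_projection (range J) P.
Hypothesis UR : representation U.
Hypothesis U_unitary : forall g, unitary (U g).
Hypothesis U_dilation :
  forall g x, J (adj (S (neg_part g)) (S (pos_part g) x)) = P (U g (J x)).
Implicit Types (x y : H) (g : finfam K int) (p : K) (ps : seq K).

Definition zdelta p : finfam K int := [fsfun [fsfun] with p |-> 1].

Let zdeltaE p q : zdelta p q = (q == p)%:Z.
Proof. by rewrite fsfun_withE finfam_zeroE; case: eqP. Qed.

Lemma pos_partD_zdelta g p : 0 <= g p ->
  pos_part (g + zdelta p) = pos_part g + finfam_delta p.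
Proof.
move=> gp; apply/fsfunP => q; apply/eqP.
rewrite -eqz_nat finfamD PoszD !pos_partE finfamD zdeltaE finfam_deltaE.
case: (eqVneq q p) => [->|_]; move: gp.
  by move: (g p) => u; lia.
by move: (g q) => u; lia.
Qed.

Lemma neg_partD_zdelta g p : 0 <= g p -> neg_part (g + zdelta p) = neg_part g.
Proof.
move=> gp; apply/fsfunP => q; apply/eqP.
rewrite -eqz_nat !neg_partE finfamD zdeltaE.
case: (eqVneq q p) => [->|_]; move: gp.
  by move: (g p) => u; lia.
by move: (g q) => u; lia.
Qed.

Lemma pos_partB_zdelta g p : g p <= 0 -> pos_part (g - zdelta p) = pos_part g.
Proof.
move=> gp; rewrite -[LHS](congr1 pos_part (opprK _)) -neg_partN.
by rewrite opprB addrC neg_partD_zdelta ?finfamN ?oppr_ge0 // neg_partN opprK.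
Qed.

Lemma neg_partB_zdelta g p : g p <= 0 ->
  neg_part (g - zdelta p) = neg_part g + finfam_delta p.
Proof.
move=> gp; rewrite neg_partN opprB addrC.
by rewrite pos_partD_zdelta ?finfamN ?oppr_ge0 // -neg_partN.
Qed.

Let B0 x y : R[i] := '[x, y].

(** Since [J x] lies in the range of [J], the vector [U g (J y)] may be replaced by its
    projection. *)
Let inner_dilation g x y :
  '[U g (J y), J x] = '[S (pos_part g) y, S (neg_part g) x].
Proof.
have [_ /(_ (J x))] := P_proj (U g (J y)); rewrite -U_dilation.
move=> h; have {}h := h (ex_intro2 _ _ x I erefl).
move: h; rewrite innerBl J_isometry => /eqP; rewrite subr_eq0 => /eqP ->.
exact: inner_toeplitz.
Qed.

Let inner_unitary g u v : '[U g u, U g v] = '[u, v].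
Proof. by rewrite adjP (U_unitary g v).1. Qed.

(* The vector [\sum_(u \subset ps) (-1)^#|u| U(-e_u) J S(e_u) x], whose squared
   norm is the Brehmer sum of [ps] at [x]. *)
Fixpoint defect_vector ps x : L :=
  if ps is p :: ps' then
    defect_vector ps' x -
    U (- zdelta p) (defect_vector ps' (S (finfam_delta p) x))
  else J x.

(** Adding [p] to the list gives four terms. Because [g p = 0], the three involving [p] all equal
    the old form after [S (finfam_delta p)] in both arguments, with signs -, - and +, which leaves
    one difference. The mixed terms shift [g], hence the general [g]. *)
Lemma inner_defect_vector ps g x y : uniq ps -> {in ps, forall p, g p = 0} ->
  '[U g (defect_vector ps y), defect_vector ps x] =
  foldr (fun p => form_diff (S (finfam_delta p))) B0 ps
    (S (pos_part g) y) (S (neg_part g) x).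
Proof.
elim: ps g x y => [|p ps IHps] g x y /=; first by rewrite inner_dilation.
case/andP=> pps us g0.
have gp : g p = 0 by apply: g0; rewrite inE eqxx.
have g0' q : q \in ps -> g q = 0 by move=> qs; apply: g0; rewrite inE qs orbT.
have gD0 q : q \in ps -> (g + zdelta p) q = 0.
  move=> qs; rewrite finfamD zdeltaE g0' //.
  by case: eqP => // qp; rewrite -qp qs in pps.
have gB0 q : q \in ps -> (g - zdelta p) q = 0.
  move=> qs; rewrite finfamD finfamN zdeltaE g0' //.
  by case: eqP => // qp; rewrite -qp qs in pps.
have U_opp u v : '[u, U (- zdelta p) v] = '[U (zdelta p) u, v].
  by rewrite -(inner_unitary (zdelta p)) -UR.2 subrr UR.1.
rewrite [U g (_ - _)]linearB !innerBl !innerBr -!UR.2 !U_opp -!UR.2.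
rewrite (addrC (zdelta p)) [zdelta p + _]addrC subrK !IHps //.
rewrite pos_partD_zdelta ?gp // neg_partD_zdelta ?gp //.
rewrite pos_partB_zdelta ?gp // neg_partB_zdelta ?gp //.
rewrite /form_diff !SR.2 !(rep_comm SR _ (finfam_delta p)); ring.
Qed.

Lemma regular_defect_ge0 ps x : uniq ps ->
  0 <= foldr (fun p => form_diff (S (finfam_delta p))) B0 ps x x.
Proof.
move=> us; have := @inner_defect_vector ps 0 x x us (fun p _ => finfam0 p).
rewrite neg_partN oppr0 pos_part0 UR.1 !SR.1 => <-.
by rewrite inner_norm exprn_ge0.
Qed.

End RegularDefect.

Theorem lemma3p4 (R : realType) (H : hilbertType R) (m : nat)
    (T : 'I_m -> 'B(H)) (Tinf : Nfam m -> 'B(H)) :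
  (0 < m)%N ->
  (forall i, contractive (T i)) ->
  (forall i j x, T i (T j x) = T j (T i x)) ->
  representation Tinf ->
  (forall i j x, Tinf (gen i j) x = T i x) ->
  regular Tinf <->
  forall n : 'I_m -> nat,
    positive_op
      (\sum_(k : {dffun forall i : 'I_m, 'I_(n i).+1})
         (((-1) ^+ (\sum_(i < m) k i)%N * \prod_(i < m) ('C(n i, k i))%:R : R[i])
          *: ((\big[comp/id]_(i < m) iter (k i) (adj (T i)))
              \o (\big[comp/id]_(i < m) iter (k (rev_ord i)) (T (rev_ord i))))
          : H -> H)).
Proof.
move=> _ _ TC TR Tgen.
have TE (p : 'I_m * nat) : Tinf (finfam_delta p) = T p.1 :> (H -> H).
  by apply/funext => x; case: p => i j; exact: Tgen.
split=> [[L [J [P [U [J_iso P_proj UR U_unit U_dil]]]]] n x|pos].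
  rewrite (defect_sum T n x).
  (* Row [i] supplies [n i] distinct generators, all sent to [T i]; this is where the infinitely
     many copies are used. *)
  pose ps := [seq (i, j) | i <- index_enum 'I_m, j <- iota 0 (n i)].
  have ps_uniq : uniq ps.
    by apply: allpairs_uniq_dep => [|i _|[i j] [i' j'] _ _ [-> ->]//];
      rewrite ?index_enum_uniq ?iota_uniq.
  have := regular_defect_ge0 TR J_iso P_proj UR U_unit U_dil x ps_uniq.
  congr (0 <= _ x x); rewrite /ps /defect.
  elim: (index_enum _) => //= i s IHs.
  rewrite foldr_cat foldr_map IHs; elim: (n i) 0%N => //= j IHj a.
  by rewrite IHj; congr form_diff; exact: (TE (i, a)).
apply: brehmer_regular TR _ => ps _.
have -> : (fun p : 'I_m * nat => Tinf (finfam_delta p) : H -> H) =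
    (fun p => T p.1).
  exact/funext.
apply: (defect_brehmer TC) => n x; rewrite -defect_sum; exact: pos.
Qed.
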